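(* Let $H=B(n,w,\gamma)$. (1) Every simple Yetter-Drinfeld module over $H$ is isomorphic to $V(\alpha,\beta,x^rg^i)$ for some scalars $\alpha,\beta\in\Bbbk^*$ and integers $r,i\in\mathbb{Z}$ satisfying $\alpha^w=\beta^n$. (2) Two such modules $V(\alpha,\beta,x^rg^i)$ and $V(\alpha',\beta',x^{r'}g^{i'})$ are isomorphic if and only if $\alpha=\alpha'$, $\beta=\beta'$ and $x^rg^i=x^{r'}g^{i'}$ in $H$.
   Context: $\Bbbk$ is an algebraically closed field of characteristic $0$; $n,w$ are positive integers and $\gamma\in\Bbbk$ is a primitive $n$-th root of unity. The generalized Liu algebra $H=B(n,w,\gamma)$ is the Hopf algebra generated by $x^{\pm1},g,y$ with relations $xx^{-1}=x^{-1}x=1$, $xg=gx$, $xy=yx$, $yg=\gamma gy$, $y^n=1-x^w=1-g^n$, with $\Delta(x)=x\otimes x$, $\Delta(g)=g\otimes g$, $\Delta(y)=y\otimes g+1\otimes y$, $\varepsilon(x)=\varepsilon(g)=1$, $\varepsilon(y)=0$, $S(x)=x^{-1}$, $S(g)=g^{-1}$, $S(y)=-yg^{-1}$. A (left-left) Yetter-Drinfeld module over $H$ is a left $H$-module and left $H$-comodule $(V,\cdot,\delta)$, $\delta(v)=v_{(-1)}\otimes v_{(0)}$, with $\delta(h\cdot v)=h_{(1)}v_{(-1)}S(h_{(3)})\otimes h_{(2)}\cdot v_{(0)}$; it is simple if it has no nonzero proper Yetter-Drinfeld submodules. For $\beta\in\Bbbk^*$ and $r,i\in\mathbb{Z}$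 define elements $c_\beta^{r,i}(k,l)\in H$ ($0\le l\le k$) recursively: $c_\beta^{r,i}(0,0)=x^rg^i$, and for $k\ge0$: $c_\beta^{r,i}(k+1,0)=c_\beta^{r,i}(k,0)S(y)+\beta y c_\beta^{r,i}(k,0)S(g)$; for $0<l<k+1$, $c_\beta^{r,i}(k+1,l)=c_\beta^{r,i}(k,l)S(y)+\beta\gamma^{-l}y c_\beta^{r,i}(k,l)S(g)+c_\beta^{r,i}(k,l-1)S(g)$; $c_\beta^{r,i}(k+1,k+1)=c_\beta^{r,i}(k,k)S(g)$. For $i\in\mathbb{Z}$ let $\phi(i)$ be the unique integer in $\{1,\dots,n\}$ with $i\equiv\phi(i)\pmod n$. For $\alpha,\beta\in\Bbbk^*$, $r,i\in\mathbb{Z}$ with $\alpha^w=\beta^n$, the module $V(\alpha,\beta,x^rg^i)$ has basis $v_0,\dots,v_m$ where $m=n-\phi(-i-j)$ if $\beta=\gamma^j$ for some $j\in\mathbb{Z}$, and $m=n-1$ if $\beta^n\ne1$; the structure is $x\cdot v_k=\alpha v_k$, $g\cdot v_k=\beta\gamma^{-k}v_k$, $y\cdot v_k=v_{k+1}$ for $0\le k<m$, $y\cdot v_m=(1-\beta^n)v_0$, and $\delta(v_k)=\sum_{l=0}^k c_\beta^{r,i}(k,l)\otimes v_l$. *)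

(* Defs.v *)
(* Concrete model of the generalized Liu algebra
   H = B(n,w,gam) via its PBW basis x^r g^a y^l (r : int, 0 <= a,l < n),
   elements of H (and of H (x) H, H (x) V, ...) as formal linear
   combinations of basis tensors; equality in H is equality of coefficients. *)
From HB Require Import structures.
From mathcomp Require Import all_boot all_order all_algebra.
Set Implicit Arguments. Unset Strict Implicit. Unset Printing Implicit Defensive.
Import GRing.Theory.
Local Open Scope ring_scope.

Section Liu.
Variable K : fieldType.
Variables (n w : nat) (gam : K).

(* index (r, a, l) stands for the basis element x^r g^a y^l *)
Definition idx := (int * nat * nat)%type.
Definition Hf := seq (K * idx).
Definition hcoef (h : Hf) (i : idx) : K := \sum_(p <- h | p.2 == i) p.1.
Definition heq (h1 h2 : Hf) : Prop := forall i, hcoef h1 i = hcoef h2 i.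
Definition reduced (i : idx) : bool := (i.1.2 < n)%N && (i.2 < n)%N.
Definition be (i : idx) : Hf := [:: (1, i)].

(* normal form of x^r g^a y^l for arbitrary a l : nat, using
   g^n = x^w and y^n = 1 - x^w (central) *)
Definition mono (r : int) (a l : nat) : Hf :=
  [seq ((-1) ^+ k * ('C((l %/ n)%N, k))%:R,
        (r + ((w * (a %/ n))%N)%:Z + ((w * k)%N)%:Z, (a %% n)%N, (l %% n)%N))
  | k <- iota 0 (l %/ n).+1].

Definition hscale (c : K) (h : Hf) : Hf := [seq (c * p.1, p.2) | p <- h].

(* product of basis elements: x^r g^a y^l * x^r' g^a' y^l'
   = gam^(l a') x^(r+r') g^(a+a') y^(l+l')   (since y g = gam g y) *)
Definition mulb (i j : idx) : Hf :=
  let: (r, a, l) := i in let: (r', a', l') := j in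
  hscale (gam ^+ (l * a')) (mono (r + r') (a + a') (l + l')).

Definition hmul (h1 h2 : Hf) : Hf :=
  flatten [seq [seq (p.1 * q.1 * c.1, c.2) | c <- mulb p.2 q.2] | p <- h1, q <- h2].

Definition hone : Hf := mono 0 0 0.
Definition hpow (h : Hf) (k : nat) : Hf := iter k (hmul h) hone.
Definition hzpow (h hinv : Hf) (z : int) : Hf :=
  match z with Posz k => hpow h k | Negz k => hpow hinv k.+1 end.

Definition Xe : Hf := mono 1 0 0.
Definition Xinv : Hf := mono (-1) 0 0.
Definition Ge : Hf := mono 0 1 0.
Definition Ginv : Hf := mono (- (w%:Z)) n.-1 0.
Definition Ye : Hf := mono 0 0 1.

(* antipode: S(x) = x^-1, S(g) = g^-1, S(y) = - y g^-1, S anti-multiplicative *)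
Definition SY : Hf := hscale (-1) (hmul Ye Ginv).
Definition Sb (i : idx) : Hf :=
  let: (r, a, l) := i in hmul (hmul (hpow SY l) (hpow Ginv a)) (hzpow Xinv Xe r).

Definition H2 := seq (K * (idx * idx)).
Definition tens (h1 h2 : Hf) : H2 := [seq (p.1 * q.1, (p.2, q.2)) | p <- h1, q <- h2].
Definition mul2 (t1 t2 : H2) : H2 :=
  flatten [seq [seq (p.1 * q.1 * c.1 * d.1, (c.2, d.2))
               | c <- mulb p.2.1 q.2.1, d <- mulb p.2.2 q.2.2] | p <- t1, q <- t2].
Definition one2 : H2 := tens hone hone.
Definition pow2 (t : H2) (k : nat) : H2 := iter k (mul2 t) one2.
Definition zpow2 (t tinv : H2) (z : int) : H2 :=
  match z with Posz k => pow2 t k | Negz k => pow2 tinv k.+1 end.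

Definition DeltaB (i : idx) : H2 :=
  let: (r, a, l) := i in
  mul2 (mul2 (zpow2 (tens Xe Xe) (tens Xinv Xinv) r) (pow2 (tens Ge Ge) a))
       (pow2 (tens Ye Ge ++ tens hone Ye) l).
Definition Dcoef (k i j : idx) : K := \sum_(p <- DeltaB k | p.2 == (i, j)) p.1.
Definition Delta2B (k : idx) : seq (K * (idx * idx * idx)) :=
  flatten [seq [seq (p.1 * q.1, (q.2.1, q.2.2, p.2.2)) | q <- DeltaB p.2.1] | p <- DeltaB k].
Definition epsb (i : idx) : K := (i.2 == 0%N)%:R.

Section YD.
Variable V : lmodType K.

(* a left H-module is given by the operators rho i of the basis elements;
   a left H-comodule by delta : V -> H (x) V (formal sums of b_i (x) v) *)
Definition actH (rho : idx -> V -> V) (h : Hf) (v : V) : V :=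
  \sum_(p <- h) p.1 *: rho p.2 v.
Definition dcomp (delta : V -> seq (idx * V)) (v : V) (i : idx) : V :=
  \sum_(p <- delta v | p.1 == i) p.2.

Definition isYD (rho : idx -> V -> V) (delta : V -> seq (idx * V)) : Prop :=
  (forall i a u v, rho i (a *: u + v) = a *: rho i u + rho i v) /\
  (forall v, actH rho hone v = v) /\
  (forall i j v, reduced i -> reduced j -> rho i (rho j v) = actH rho (mulb i j) v) /\
  (forall v, all (fun p => reduced p.1) (delta v)) /\
  (forall a u v i, dcomp delta (a *: u + v) i = a *: dcomp delta u i + dcomp delta v i) /\
  (forall v, \sum_(p <- delta v) epsb p.1 *: p.2 = v) /\
  (forall v i j, reduced i -> reduced j ->
     \sum_(p <- delta v) Dcoef p.1 i j *: p.2
     = \sum_(p <- delta v | p.1 == i) dcomp delta p.2 j) /\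
  (forall k v m, reduced k -> reduced m ->
     dcomp delta (rho k v) m
     = \sum_(t <- Delta2B k) \sum_(p <- delta v)
          (t.1 * hcoef (hmul (hmul (be t.2.1.1) (be p.1)) (Sb t.2.2)) m)
            *: rho t.2.1.2 p.2).

Definition YDsub (rho : idx -> V -> V) (delta : V -> seq (idx * V)) (W : V -> Prop) : Prop :=
  W 0 /\ (forall a u v, W u -> W v -> W (a *: u + v)) /\
  (forall k v, reduced k -> W v -> W (rho k v)) /\
  (forall v i, W v -> W (dcomp delta v i)).

Definition simpleYD (rho : idx -> V -> V) (delta : V -> seq (idx * V)) : Prop :=
  (exists v : V, v != 0) /\
  forall W, YDsub rho delta W -> (forall v, W v -> v = 0) \/ (forall v, W v).
End YD.

Definition YDiso (V V' : lmodType K) (rho : idx -> V -> V) (delta : V -> seq (idx * V))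
    (rho' : idx -> V' -> V') (delta' : V' -> seq (idx * V')) : Prop :=
  exists f : V -> V',
    (forall a u v, f (a *: u + v) = a *: f u + f v) /\ bijective f /\
    (forall k v, reduced k -> f (rho k v) = rho' k (f v)) /\
    (forall v i, f (dcomp delta v i) = dcomp delta' (f v) i).

Definition phi (z : int) : nat := (absz ((z - 1) %% n)%Z).+1.
Definition mdim (bet : K) (i : int) : nat :=
  if [pick j : 'I_n | bet == gam ^+ j] is Some j then (n - phi (- i - (j : nat)%:Z))%N
  else n.-1.

Section VMod.
Variables (al bet : K) (r i : int).
Let m := mdim bet i.

Definition Gop (v : 'rV[K]_m.+1) : 'rV[K]_m.+1 :=
  \row_(k < m.+1) (bet * (gam ^+ k)^-1 * v 0 k).
Definition Yop (v : 'rV[K]_m.+1) : 'rV[K]_m.+1 :=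
  \row_(k < m.+1) (if k == ord0 then (1 - bet ^+ n) * v 0 ord_max else v 0 (inord k.-1)).
Definition Vrho (j : idx) (v : 'rV[K]_m.+1) : 'rV[K]_m.+1 :=
  let: (r', a, l) := j in al ^ r' *: iter a Gop (iter l Yop v).

Definition cstart : Hf := hmul (hzpow Xe Xinv r) (hzpow Ge Ginv i).
Fixpoint cc (k : nat) : nat -> Hf :=
  match k with
  | 0 => fun l => if l == 0%N then cstart else [::]
  | k'.+1 => let c := cc k' in fun l =>
      if l == 0%N then hmul (c 0%N) SY ++ hscale bet (hmul (hmul Ye (c 0%N)) Ginv)
      else if (l < k'.+1)%N then
        hmul (c l) SY ++ hscale (bet * (gam ^+ l)^-1) (hmul (hmul Ye (c l)) Ginv)
        ++ hmul (c l.-1) Ginv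
      else if l == k'.+1 then hmul (c k') Ginv
      else [::]
  end.

Definition Vdelta (v : 'rV[K]_m.+1) : seq (idx * 'rV[K]_m.+1) :=
  flatten [seq [seq (p.2, (v 0 k * p.1) *: delta_mx 0 l) | p <- cc k l]
          | k <- enum 'I_m.+1, l <- enum 'I_m.+1].
End VMod.
End Liu.

(* Main.v *)
(* (1) A top y-degree component of the coaction of a nonzero vector of a simple module V is a vector v
   with delta(v) = h (x) v, h = x^r g^i.  Since x is central and group-like it commutes with the
   action and the coaction, so every x - c is zero or surjective on V; as V is generated by v, it is
   finitely generated over K[x, x^-1], and surjectivity of x - 1 yields by the determinant trick a
   nonzero polynomial in x killing v.  Hence x acts by a scalar alpha, and v may be chosen to be an
   eigenvector of g, of eigenvalue beta.  The vectors v_k = y^k v have coaction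
   sum_l c(k,l) (x) v_l, where c(k,l) is, up to a power of gamma, a Gaussian binomial times
   prod_(l <= s < k) (beta gamma^(i-s) - 1) times x^r g^(i-k) y^(k-l).  The coefficients of c(k,0)
   are nonzero for k <= m, which separates v_0, ..., v_m; all c(m+1,l), l <= m, vanish if m + 1 < n,
   so v_(m+1) is group-like and would generate V = y V if nonzero, although y is then nilpotent.
   (2) In V(alpha, beta, h) the nonvanishing of c(k,0) shows that every group-like vector is a
   multiple of v_0, with coaction h (x) v_0, so an isomorphism preserves h, alpha and beta. *)
Require Import Defs.
From HB Require Import structures.
From mathcomp Require Import all_boot all_order all_algebra.
From mathcomp Require Import zify ring.
Import GRing.Theory.
Local Open Scope ring_scope.

Set Implicit Arguments. Unset Strict Implicit. Unset Printing Implicit Defensive.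

(** * Linear operators and polynomials in them *)

Section LinearOperators.
Variable K : fieldType.
Variables (V V' : lmodType K) (T : V -> V').
Hypothesis T_lin : forall a u v, T (a *: u + v) = a *: T u + T v.

Lemma op0 : T 0 = 0.
Proof. by have := T_lin (-1) 0 0; rewrite scaler0 addr0 scaleN1r addNr. Qed.

Lemma opD u v : T (u + v) = T u + T v.
Proof. by have := T_lin 1 u v; rewrite !scale1r. Qed.

Lemma opZ a u : T (a *: u) = a *: T u.
Proof. by have := T_lin a u 0; rewrite op0 !addr0. Qed.

Lemma op_sum (I : Type) (s : seq I) (P : pred I) (F : I -> V) :
  T (\sum_(i <- s | P i) F i) = \sum_(i <- s | P i) T (F i).
Proof. exact: (big_morph T opD op0). Qed.

End LinearOperators.

Section LinearEndomorphisms.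
Variables (K : fieldType) (V : lmodType K) (T : V -> V).
Hypothesis T_lin : forall a u v, T (a *: u + v) = a *: T u + T v.

Lemma iter_lin k a u v : iter k T (a *: u + v) = a *: iter k T u + iter k T v.
Proof. by elim: k => //= k ->; rewrite T_lin. Qed.

Lemma iterZ k a u : iter k T (a *: u) = a *: iter k T u.
Proof. by elim: k => //= k ->; rewrite (opZ T_lin). Qed.

Lemma op_iterD k u v : iter k T (u + v) = iter k T u + iter k T v.
Proof. by elim: k => //= k ->; rewrite (opD T_lin). Qed.

Lemma iter_sum k (I : Type) (s : seq I) (F : I -> V) :
  iter k T (\sum_(i <- s) F i) = \sum_(i <- s) iter k T (F i).
Proof. by elim: k => //= k ->; rewrite (op_sum T_lin). Qed.

Lemma iter_op0 k : iter k T 0 = 0.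
Proof. by elim: k => //= k ->; rewrite (op0 T_lin). Qed.
End LinearEndomorphisms.

Section PolynomialAction.
Variables (K : fieldType) (V : lmodType K) (T : V -> V).
Hypothesis T_lin : forall a u v, T (a *: u + v) = a *: T u + T v.

Definition pact (p : {poly K}) (x : V) : V := \sum_(i < size p) p`_i *: iter i T x.

Lemma pact_wide N (p : {poly K}) x : (size p <= N)%N -> pact p x = \sum_(i < N) p`_i *: iter i T x.
Proof.
move=> pN; rewrite /pact (big_ord_widen N (fun i => p`_i *: iter i T x) pN).
rewrite [LHS]big_mkcond; apply: eq_bigr => i _; case: ifP => // /negbT.
by rewrite -leqNgt => ?; rewrite nth_default // scale0r.
Qed.

Lemma pactD p p' x : pact (p + p') x = pact p x + pact p' x.
Proof.
rewrite (@pact_wide (maxn (size p) (size p')) p) ?leq_maxl //.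
rewrite (@pact_wide (maxn (size p) (size p')) p') ?leq_maxr //.
rewrite (@pact_wide (maxn (size p) (size p'))) ?size_polyD // -big_split /=.
by apply: eq_bigr => i _; rewrite coefD scalerDl.
Qed.

Lemma pact_lin p a u v : pact p (a *: u + v) = a *: pact p u + pact p v.
Proof.
rewrite /pact scaler_sumr -big_split; apply: eq_bigr => i _ /=.
by rewrite (iter_lin T_lin) scalerDr !scalerA mulrC.
Qed.

Lemma pactC c x : pact c%:P x = c *: x.
Proof.
rewrite (@pact_wide 1) ?size_polyC_leq1 //.
by rewrite big_ord_recl big_ord0 addr0 coefC.
Qed.

Lemma pactMX p x : pact (p * 'X) x = pact p (T x).
Proof.
rewrite (@pact_wide (size p).+1).
  rewrite big_ord_recl coefMX scale0r add0r; apply: eq_bigr => i _.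
  by rewrite coefMX /= -iterSr.
by rewrite (leq_trans (size_polyMleq _ _)) // size_polyX addn2.
Qed.

Lemma pact_T p x : pact p (T x) = T (pact p x).
Proof. by rewrite /pact (op_sum T_lin); apply: eq_bigr => i _; rewrite -iterSr iterS (opZ T_lin). Qed.

Lemma pactCM c p x : pact (c%:P * p) x = c *: pact p x.
Proof.
rewrite (@pact_wide (size p)) ?scaler_sumr; last first.
  by rewrite mul_polyC size_scale_leq.
by apply: eq_bigr => i _; rewrite coefCM scalerA.
Qed.

Lemma pactN p x : pact (- p) x = - pact p x.
Proof. by rewrite -[- p]mulN1r -polyC1 -polyCN pactCM scaleN1r. Qed.

Lemma pactM p p' x : pact (p * p') x = pact p (pact p' x).
Proof.
elim/poly_ind: p p' x => [|p c IHp] p' x.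
  by rewrite mul0r !/(pact 0 _) /pact size_poly0 !big_ord0.
rewrite mulrDl !pactD -mulrA [_ * p']mulrC [p * _]mulrA pactMX pactMX IHp.
by rewrite pactCM pactC !pact_T.
Qed.

Lemma pactX x : pact 'X x = T x.
Proof. by rewrite -['X]mul1r pactMX pactC scale1r. Qed.

Lemma pactXn k x : pact 'X^k x = iter k T x.
Proof. by elim: k => [|k IHk]; rewrite ?pactC ?scale1r // exprS pactM IHk pactX. Qed.

Lemma pact_sum (I : Type) (s : seq I) (F : I -> {poly K}) x :
  pact (\sum_(i <- s) F i) x = \sum_(i <- s) pact (F i) x.
Proof.
apply: (big_morph (fun p => pact p x)) => [p p'|]; first exact: pactD.
by rewrite /pact size_poly0 big_ord0.
Qed.

(** The determinant trick: since [\adj M *m M] is scalar with entry [\det M], the vector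
    [pact (\det M) (e i)] is a combination of the vanishing row relations. *)
Lemma pact_det N (M : 'M[{poly K}]_N) (e : 'I_N -> V) :
  (forall i, \sum_j pact (M i j) (e j) = 0) -> forall i, pact (\det M) (e i) = 0.
Proof.
move=> Me i.
have -> : pact (\det M) (e i) = \sum_k pact ((\adj M *m M) i k) (e k).
  rewrite mul_adj_mx (bigD1 i) //= big1 ?addr0 => [|k ki]; last first.
    by rewrite mxE eq_sym (negPf ki) mulr0n /pact size_poly0 big_ord0.
  by rewrite mxE eqxx.
under eq_bigr do rewrite mxE pact_sum.
rewrite exchange_big big1 //= => j _.
under eq_bigr do rewrite pactM.
by rewrite -(op_sum (pact_lin (\adj M i j))) Me (op0 (pact_lin _)).
Qed.

(** Roots are stripped one at a time: either [v] is an eigenvector for [z], or [T v - z *: v] is a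
    nonzero vector of [P] killed by the remaining factors. *)
Lemma eigenvector_of_split (P : V -> Prop) (s : seq K) v :
  (forall a u u', P u -> P u' -> P (a *: u + u')) -> (forall u, P u -> P (T u)) ->
  P v -> v != 0 -> pact (\prod_(z <- s) ('X - z%:P)) v = 0 ->
  exists z u, [/\ u != 0, P u & T u = z *: u].
Proof.
move=> PD PT; elim: s v => [|z s IHs] v Pv v0.
  by rewrite big_nil pactC scale1r => /eqP; rewrite (negPf v0).
have XsubE u : pact ('X - z%:P) u = T u - z *: u.
  by rewrite -polyCN pactD pactX pactC scaleNr.
have [Tv|Tv] := eqVneq (T v - z *: v) 0.
  by move=> _; exists z, v; split=> //; apply/eqP; rewrite -subr_eq0 Tv.
rewrite big_cons mulrC pactM XsubE; apply: IHs => //.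
by rewrite addrC -scaleNr; apply: PD => //; apply: PT.
Qed.
End PolynomialAction.
(** * Formal linear combinations *)

Section FormalSums.
Variable K : fieldType.

(** A tensor has many representing lists; for [F] additive in its second argument, terms with equal
    index may be collected first. *)
Lemma fsum_undup (I : eqType) (V W : zmodType) (F : I -> V -> W) (h : seq (I * V)) (s : seq I) :
  (forall i, F i 0 = 0) -> (forall i, {morph F i : u v / u + v}) ->
  uniq s -> {subset [seq p.1 | p <- h] <= s} ->
  \sum_(p <- h) F p.1 p.2 = \sum_(i <- s) F i (\sum_(p <- h | p.1 == i) p.2).
Proof.
move=> F0 FD us hs; under [RHS]eq_bigr do rewrite (big_morph _ (FD _) (F0 _)).
rewrite (exchange_big_dep xpredT) //=; apply: eq_big_seq => p hp.
rewrite (big_rem p.1) /=; last by apply/hs/map_f.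
rewrite eqxx big_seq_cond big1 ?addr0 // => i /andP[].
by rewrite mem_rem_uniq // !inE => /andP[/negPf ip _] /eqP pi; rewrite pi eqxx in ip.
Qed.

Lemma eq_fsum (I : eqType) (V W : zmodType) (F : I -> V -> W) (h h' : seq (I * V)) :
  (forall i, F i 0 = 0) -> (forall i, {morph F i : u v / u + v}) ->
  (forall i, \sum_(p <- h | p.1 == i) p.2 = \sum_(p <- h' | p.1 == i) p.2) ->
  \sum_(p <- h) F p.1 p.2 = \sum_(p <- h') F p.1 p.2.
Proof.
move=> F0 FD hh'; have us := undup_uniq [seq p.1 | p <- h ++ h'].
rewrite !(fsum_undup F0 FD us); first by apply: eq_bigr => i _; rewrite hh'.
- by move=> i hi; rewrite mem_undup map_cat mem_cat hi orbT.
- by move=> i hi; rewrite mem_undup map_cat mem_cat hi.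
Qed.

Lemma hcoefE (h : Hf K) m : hcoef h m = \sum_(p <- h) p.1 * (p.2 == m)%:R.
Proof.
rewrite /hcoef big_mkcond; apply: eq_bigr => p _.
by case: eqP; rewrite ?mulr1 ?mulr0.
Qed.

Lemma hcoef1 (c : K) i m : hcoef [:: (c, i)] m = c * (i == m)%:R.
Proof. by rewrite hcoefE big_seq1. Qed.

Lemma hcoef_cat (h1 h2 : Hf K) m : hcoef (h1 ++ h2) m = hcoef h1 m + hcoef h2 m.
Proof. by rewrite !hcoefE big_cat. Qed.

Lemma hcoef_scale (c : K) (h : Hf K) m : hcoef (hscale c h) m = c * hcoef h m.
Proof.
by rewrite !hcoefE big_map mulr_sumr; apply: eq_bigr => p _; rewrite mulrA.
Qed.

Lemma heq_sum (h h' : Hf K) (F : idx -> K) :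
  heq h h' -> \sum_(p <- h) p.1 * F p.2 = \sum_(p <- h') p.1 * F p.2.
Proof.
move=> hh'; have := @eq_fsum _ K K (fun i c => c * F i)
  [seq (p.2, p.1) | p <- h] [seq (p.2, p.1) | p <- h'].
rewrite !big_map; apply; first by move=> i; rewrite mul0r.
  by move=> i u v; rewrite mulrDl.
by move=> i; rewrite !big_map; apply: hh'.
Qed.

Lemma heq_cat (h1 h1' h2 h2' : Hf K) :
  heq h1 h1' -> heq h2 h2' -> heq (h1 ++ h2) (h1' ++ h2').
Proof. by move=> e1 e2 m; rewrite !hcoef_cat e1 e2. Qed.

Lemma heq_scale (c : K) (h h' : Hf K) : heq h h' -> heq (hscale c h) (hscale c h').
Proof. by move=> e m; rewrite !hcoef_scale e. Qed.

Lemma heq_trans (h1 h2 h3 : Hf K) : heq h1 h2 -> heq h2 h3 -> heq h1 h3.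
Proof. by move=> e1 e2 m; rewrite e1 e2. Qed.

End FormalSums.

(** * The generalized Liu algebra *)

Section Algebra.
Variables (K : fieldType) (n w : nat) (gam : K).
Hypothesis n_gt0 : (0 < n)%N.
Hypothesis gam_prim : n.-primitive_root gam.

Local Notation mulb := (mulb n w gam).
Local Notation hmul := (hmul n w gam).
Local Notation mono := (@mono K n w).
Local Notation SY := (SY n w gam).
Local Notation Ye := (@Ye K n w).
Local Notation Ginv := (@Ginv K n w).

Lemma hcoef_hmul (h1 h2 : Hf K) m :
  hcoef (hmul h1 h2) m =
  \sum_(p <- h1) p.1 * (\sum_(q <- h2) q.1 * hcoef (mulb p.2 q.2) m).
Proof.
rewrite hcoefE /Defs.hmul big_flatten big_allpairs_dep.
apply: eq_bigr => p _; rewrite mulr_sumr; apply: eq_bigr => q _.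
rewrite big_map hcoefE !mulr_sumr; apply: eq_bigr => c _.
by rewrite -!mulrA.
Qed.

Lemma heq_hmul (h1 h1' h2 h2' : Hf K) :
  heq h1 h1' -> heq h2 h2' -> heq (hmul h1 h2) (hmul h1' h2').
Proof.
move=> e1 e2 m; rewrite !hcoef_hmul.
rewrite (heq_sum (fun i => \sum_(q <- h2) q.1 * hcoef (mulb i q.2) m) e1).
by apply: eq_bigr => p _; rewrite (heq_sum (fun j => hcoef (mulb p.2 j) m) e2).
Qed.

(* The index of x^r g^z y^l for an integer z, reduced by means of g^n = x^w. *)
Definition pbw (r z : int) (l : nat) : idx :=
  (r + w%:Z * (z %/ n)%Z, absz (z %% n)%Z, l).

Arguments pbw : simpl never.
Arguments DeltaB : simpl never.
Arguments Sb : simpl never.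
Arguments Defs.mulb : simpl never.

Let n_neq0 : n%:Z != 0. Proof. by lia. Qed.

Lemma absz_mod (z : int) : (absz (z %% n)%Z)%:Z = (z %% n)%Z.
Proof. by rewrite gez0_abs ?modz_ge0. Qed.

Lemma reduced_pbw r z l : reduced n (pbw r z l) = (l < n)%N.
Proof.
rewrite /reduced /= -ltz_nat absz_mod.
by rewrite [X in X && _](_ : _ = true) // ltz_pmod.
Qed.

Lemma pbw_nat r (a l : nat) : (a < n)%N -> pbw r a l = (r, a, l).
Proof. by move=> an; rewrite /pbw divz_nat modz_nat divn_small ?modn_small ?mulr0 ?addr0. Qed.

Lemma pbw_reduced (i : idx) : reduced n i -> i = pbw i.1.1 i.1.2 i.2.
Proof. by case: i => [[r a] l] /andP[/= an _]; rewrite pbw_nat. Qed.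

Lemma eq_pbw r z l r' z' l' :
  (pbw r z l == pbw r' z' l') = (pbw r z 0 == pbw r' z' 0) && (l == l').
Proof. by rewrite /pbw !xpair_eqE eqxx andbT. Qed.

(** Apart from commutation, g^n = x^w is the only relation between x and g; [d] is the difference of
    the quotients of [z'] and [z] by [n]. *)
Lemma pbw_inj r z l r' z' l' : pbw r z l = pbw r' z' l' ->
  exists2 d : int, z' = z + d * n & r = r' + w%:Z * d.
Proof.
case=> e1 /(congr1 Posz); rewrite !absz_mod => e2 _.
have := divz_eq z n; have := divz_eq z' n; rewrite -e2.
move: (z %% n)%Z (z' %/ n)%Z (z %/ n)%Z e1 => m d' d e1 -> ->.
exists (d' - d); first by ring.
by move/eqP: e1; rewrite -subr_eq => /eqP <-; ring.
Qed.

Lemma pbw_shift r z l (d : int) : pbw (r + w%:Z * d) z l = pbw r (z + d * n) l.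
Proof.
rewrite /pbw [z + _]addrC divzMDl // modzMDl; congr (_, _, _).
by ring.
Qed.

Lemma gam_neq0 : gam != 0.
Proof. by rewrite (prim_root_eq0 gam_prim) -lt0n. Qed.

Lemma gam_exp_mod (l : nat) (z : int) : gam ^+ (l * absz (z %% n)%Z) = gam ^ (l%:Z * z).
Proof.
rewrite -[gam ^+ _]/(gam ^ (_ : nat)%:Z) PoszM absz_mod.
have := divz_eq z n; move: (z %% n)%Z (z %/ n)%Z => m d ->.
rewrite (_ : l%:Z * (d * n%:Z + m) = n%:Z * (d * l%:Z) + l%:Z * m); last by ring.
rewrite expfzDr ?gam_neq0 // -(exprz_exp _ n%:Z).
have -> : gam ^ n%:Z = 1 := prim_expr_order gam_prim.
by rewrite exp1rz mul1r.
Qed.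

(** Below y-degree [n] the relation y^n = 1 - x^w is never applied, so a single term remains. *)
Lemma monoE r (a l : nat) : (l < n)%N -> mono r a l = [:: (1, pbw r a l)].
Proof.
move=> ln; rewrite /Defs.mono /pbw (divn_small ln) /= bin0 (modn_small ln) divz_nat modz_nat /=.
by rewrite muln0 addr0 mulr1 PoszM.
Qed.

Lemma mulbE r z l r' z' l' : (l + l' < n)%N ->
  mulb (pbw r z l) (pbw r' z' l') = [:: (gam ^ (l%:Z * z'), pbw (r + r') (z + z') (l + l'))].
Proof.
move=> ln; rewrite {1}/pbw {1}/pbw /Defs.mulb (monoE _ _ ln) /= mulr1 gam_exp_mod; congr [:: (_, _)].
rewrite PoszD !absz_mod.
have := divz_eq z n; have := divz_eq z' n.
move: (z %% n)%Z (z' %% n)%Z (z' %/ n)%Z (z %/ n)%Z => m m' d' d -> ->.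
rewrite [in RHS](_ : d * n%:Z + m + (d' * n%:Z + m') = m + m' + (d + d') * n); last by ring.
by rewrite -pbw_shift; congr pbw; ring.
Qed.

Lemma hmul1 (c d e : K) i j k : mulb i j = [:: (e, k)] ->
  hmul [:: (c, i)] [:: (d, j)] = [:: (c * d * e, k)].
Proof. by move=> H; rewrite /Defs.hmul /= H. Qed.

Lemma hmulE (c d : K) r z l r' z' l' : (l + l' < n)%N ->
  hmul [:: (c, pbw r z l)] [:: (d, pbw r' z' l')] =
  [:: (c * d * gam ^ (l%:Z * z'), pbw (r + r') (z + z') (l + l'))].
Proof. by move=> ln; apply/hmul1/mulbE. Qed.

Lemma honeE : @hone K n w = [:: (1, pbw 0 0 0)].
Proof. by rewrite /hone monoE. Qed.

Lemma GinvE : Ginv = [:: (1, pbw 0 (-1) 0)].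
Proof.
rewrite /Defs.Ginv monoE //; congr [:: (_, _)].
(* The encoded inverse x^(-w) g^(n-1) becomes g^(-1) by a shift with d = -1. *)
rewrite (_ : - w%:Z = 0 + w%:Z * (-1)) ?pbw_shift; last by ring.
congr pbw; lia.
Qed.

Lemma YeE : (1 < n)%N -> Ye = [:: (1, pbw 0 0 1)].
Proof. by move=> n1; rewrite /Defs.Ye monoE. Qed.

(** Moving y past g^(-1) costs a factor gam^(-1): y g^(-1) = gam^(-1) g^(-1) y. *)
Lemma SYE : (1 < n)%N -> SY = [:: (- gam ^-1, pbw 0 (-1) 1)].
Proof.
move=> n1; rewrite /Defs.SY YeE // GinvE hmulE //= !add0r addn0 mul1r.
by rewrite !mul1r mulN1r.
Qed.

Lemma hpowE r z k : hpow n w gam [:: (1, pbw r z 0)] k = [:: (1, pbw (r *~ k) (z *~ k) 0)].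
Proof.
elim: k => [|k IHk]; first by rewrite /hpow /= honeE !mulr0z.
rewrite /hpow /= -/(hpow n w gam _ k) IHk hmulE // mul0r expr0z !mulr1.
by rewrite -!pmulrn !mulrS.
Qed.

Lemma XeE : @Xe K n w = [:: (1, pbw 1 0 0)]. Proof. by rewrite /Xe monoE. Qed.
Lemma XinvE : @Xinv K n w = [:: (1, pbw (-1) 0 0)]. Proof. by rewrite /Xinv monoE. Qed.
Lemma GeE : @Ge K n w = [:: (1, pbw 0 1 0)]. Proof. by rewrite /Ge monoE. Qed.

Lemma hzpowE r z r' z' k : r' = - r -> z' = - z ->
  hzpow n w gam [:: (1, pbw r z 0)] [:: (1, pbw r' z' 0)] k = [:: (1, pbw (r * k) (z * k) 0)].
Proof.
move=> -> ->; case: k => k; rewrite /hzpow hpowE.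
  by rewrite -!mulrzz.
by rewrite !mulNrz !NegzE !mulrN -!mulrzz.
Qed.

(** * Closed form of the elements c(k,l) *)

Lemma cstartE r i : cstart n w gam r i = [:: (1, pbw r i 0)].
Proof.
rewrite /cstart XeE XinvE GeE GinvE !hzpowE ?oppr0 // hmulE // mul0r expr0z !mulr1.
by rewrite !mul1r !mul0r addr0 add0r.
Qed.

(* A power of q times the Gaussian binomial coefficient: the part of the coefficient of
   x^r g^(i-k) y^(k-l) in c(k,l) that does not depend on beta. *)
Fixpoint theta (q : K) (k l : nat) : K :=
  match k, l with
  | 0, 0 => 1
  | 0, _.+1 => 0
  | k'.+1, 0 => q ^+ k'.+1 * theta q k' 0
  | k'.+1, l'.+1 => q ^+ k'.+1 * theta q k' l'.+1 + theta q k' l'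
  end.

Lemma thetaSS q k l : theta q k.+1 l.+1 = q ^+ k.+1 * theta q k l.+1 + theta q k l.
Proof. by []. Qed.

(** The dual q-Pascal rule. For l <= k, [theta q k l] is the elementary symmetric polynomial of
    degree k - l in q, ..., q^k; the defining rule splits off the last variable, while this one
    takes out a factor q from every variable and then splits off the first. The factor [q ^+ l]
    avoids the exponent k - l. *)
Lemma thetaS q k l :
  q ^+ l * theta q k.+1 l.+1 = q ^+ k * (theta q k l.+1 + theta q k l).
Proof.
elim: k l => [|k IHk] l; first by case: l => [|l] /=; ring.
rewrite [theta q k.+2 l.+1]thetaSS mulrDr mulrCA IHk.
case: l => [|l].
  by rewrite thetaSS [theta q k.+1 0]/= !exprS; ring.
by rewrite [q ^+ l.+1]exprS -[_ * q ^+ l * _]mulrA IHk !thetaSS !exprS; ring.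
Qed.

Lemma theta_gt q k l : (k < l)%N -> theta q k l = 0.
Proof.
elim: k l => [|k IHk] [|l] //= kl; rewrite !IHk ?mulr0 ?addr0 //.
exact: ltnW.
Qed.

Lemma theta_diag q k : theta q k k = 1.
Proof. by elim: k => //= k ->; rewrite theta_gt // mulr0 add0r. Qed.

Lemma theta0_neq0 q k : q != 0 -> theta q k 0 != 0.
Proof. by move=> q0; elim: k => [|k IHk] /=; rewrite ?oner_eq0 // mulf_neq0 // expf_neq0. Qed.

Arguments theta : simpl never.

Local Notation q := (gam^-1).

(** Here [b] stands for bet * gam^i. The first zero of a factor b q^s - 1 decides where the basis of
    the module stops. *)
Definition ccoef (b : K) (k l : nat) : K :=
  theta q k l * \prod_(l <= s < k) (b * q ^+ s - 1).

Lemma ccoef_diag b k : ccoef b k k = 1.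
Proof. by rewrite /ccoef theta_diag big_geq // mulr1. Qed.

Lemma ccoefS0 b k : ccoef b k.+1 0 = q ^+ k.+1 * (ccoef b k 0 * (b * q ^+ k - 1)).
Proof. by rewrite /ccoef big_nat_recr //= !mulrA. Qed.

Lemma ccoefS b k l : (l < k)%N ->
  ccoef b k.+1 l.+1 =
  q ^+ (k - l) * (ccoef b k l.+1 * (b * q ^+ (k + l.+1) - 1) + ccoef b k l).
Proof.
move=> lk; rewrite /ccoef (@big_nat_recr _ _ _ k) // (@big_ltn _ _ _ l k) //=.
have ql0 : q ^+ l != 0 by rewrite expf_neq0 // invr_eq0 gam_neq0.
move: (\prod_(_ <= _ < _) _) => P.
(* After multiplication by q^l and up to the common factor [P], the parts free of b agree by
   [thetaS], and the parts linear in b by [thetaS] together with the defining rule. *)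
apply: (mulfI ql0).
rewrite [LHS]mulrA thetaS.
rewrite [q ^+ l * (q ^+ (k - l) * _)]mulrA -exprD subnKC 1?ltnW //.
have := thetaS q k l.
rewrite thetaSS => H.
have -> : q ^+ k * (theta q k l.+1 + theta q k l) * (P * (b * q ^+ k - 1)) =
   P * (b * q ^+ k * (q ^+ k * (theta q k l.+1 + theta q k l)) - q ^+ k * (theta q k l.+1 + theta q k l)) by ring.
rewrite -{1}H exprD !exprS; ring.
Qed.

Lemma heq_merge (c d : K) i : heq ([:: (c, i)] ++ [:: (d, i)]) [:: (c + d, i)].
Proof. by move=> m; rewrite hcoef_cat !hcoef1 mulrDl. Qed.

Lemma gam_expN (d : nat) : gam ^ (d%:Z * -1) = q ^+ d.
Proof. by rewrite mulrN1 -exprz_inv. Qed.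

Lemma cc_gt bet r i k l : (k < l)%N -> cc n w gam bet r i k l = [::].
Proof.
case: k => [|k] kl /=; first by rewrite -if_neg -lt0n kl.
by rewrite !ifN //; lia.
Qed.

(** Every c(k,l) is a single monomial: all summands of the recursion are multiples of the same x^r
    g^(i-k-1) y^(k+1-l), and their scalars add up by [ccoefS0] and [ccoefS]. The bound k < n
    prevents any reduction of y^n. *)
Lemma ccE bet r i k l : (k < n)%N -> (l <= k)%N ->
  heq (cc n w gam bet r i k l) [:: (ccoef (bet * gam ^ i) k l, pbw r (i - k%:Z) (k - l))].
Proof.
set b := bet * gam ^ i.
elim: k l => [|k IHk] l kn lk.
  by case: l lk => //= _; rewrite cstartE ccoef_diag subr0.
have n1 : (1 < n)%N by lia.
(* [HS], [HY] and [HG] evaluate the three kinds of summands. The first two share their monomial and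
   combine to a factor b q^(k+l') - 1. *)
have HS l' : (l' <= k)%N -> heq (hmul (cc n w gam bet r i k l') SY)
    [:: (- (q ^+ (k - l').+1 * ccoef b k l'), pbw r (i - k.+1%:Z) (k.+1 - l'))].
  move=> lk'; apply: heq_trans (heq_hmul (IHk _ (ltnW kn) lk') (fun=> erefl)) _.
  rewrite SYE // hmulE; last by lia.
  rewrite gam_expN => m; congr (hcoef [:: (_, pbw _ _ _)] m); last by lia.
  - by rewrite exprS; ring.
  - by rewrite addr0.
  - by lia.
have HY l' : (l' <= k)%N ->
    heq (hscale (bet * (gam ^+ l')^-1) (hmul (hmul Ye (cc n w gam bet r i k l')) Ginv))
    [:: (q ^+ (k - l').+1 * (ccoef b k l' * (b * q ^+ (k + l'))), pbw r (i - k.+1%:Z) (k.+1 - l'))].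
  move=> lk'.
  apply: heq_trans (heq_scale _ (heq_hmul (heq_hmul (fun=> erefl) (IHk _ (ltnW kn) lk')) (fun=> erefl))) _.
  rewrite YeE // GinvE hmulE; last by lia.
  rewrite hmulE; last by lia.
  rewrite gam_expN !mul1r expfzDr ?gam_neq0 // /hscale /= => m.
  congr (hcoef [:: (_, pbw _ _ _)] m); [|lia..].
  by rewrite -exprVn /b [q ^+ (k + l')]exprD -exprz_inv -[q ^ k]/(q ^+ k); ring.
have HG l' : (l' <= k)%N -> heq (hmul (cc n w gam bet r i k l') Ginv)
    [:: (q ^+ (k - l') * ccoef b k l', pbw r (i - k.+1%:Z) (k - l'))].
  move=> lk'; apply: heq_trans (heq_hmul (IHk _ (ltnW kn) lk') (fun=> erefl)) _.
  rewrite GinvE hmulE; last by lia.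
  rewrite gam_expN => m; congr (hcoef [:: (_, pbw _ _ _)] m); [ring|lia..].
rewrite /=; case: eqP => [->|/eqP l0].
  rewrite subn0; apply: heq_trans (heq_cat (HS 0 isT) _) _.
    by have := HY 0 isT; rewrite expr0 invr1 mulr1; apply.
  move=> m; rewrite (heq_merge _ _ _) subn0 addn0 ccoefS0.
  by congr (hcoef [:: (_, _)] _); ring.
case: l l0 lk => // l _ lk; rewrite ltnS.
case: ltnP => lk'; last first.
  have -> : l = k by lia.
  rewrite eqxx subnn ccoef_diag.
  by move=> m; rewrite (HG _ (leqnn _)) subnn expr0 mul1r ccoef_diag.
apply: heq_trans (heq_cat (HS _ lk') (heq_cat (HY _ lk') (HG l _))) _; first by lia.
move=> m; rewrite !hcoef_cat !hcoef1 ccoefS //.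
rewrite !subSS -subSn // subSS; ring.
Qed.

(** * Comultiplication and antipode on the basis *)

Lemma mem_mulb (i j : idx) c : c \in mulb i j -> reduced n c.2.
Proof.
case: i j => [[r a] l] [[r' a'] l']; rewrite /Defs.mulb /hscale => /mapP[c' cm ->].
move: cm; rewrite /Defs.mono => /mapP[k _ ->].
by rewrite /reduced /= !ltn_pmod.
Qed.

Lemma mem_mulb_degree (i j : idx) c : (i.2 + j.2 < n)%N -> c \in mulb i j -> c.2.2 = (i.2 + j.2)%N.
Proof.
case: i j => [[r a] l] [[r' a'] l'] ln; rewrite /Defs.mulb /hscale => /mapP[c' cm ->].
move: cm; rewrite /Defs.mono => /mapP[k _ ->] /=.
by rewrite modn_small.
Qed.

Local Notation mul2 := (mul2 n w gam).
Local Notation pow2 := (pow2 n w gam).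

Lemma mem_mul2 (t u : H2 K) x : x \in mul2 t u ->
  exists p q, exists2 c, p \in t /\ q \in u & exists2 d, c \in mulb p.2.1 q.2.1 /\ d \in mulb p.2.2 q.2.2 &
    x.2 = (c.2, d.2).
Proof.
case/flattenP => s /allpairsP[[p u'] /= [pt uu ->]] /allpairsP[[c d] /= [cm dm ->]] /=.
by exists p, u', c => //; exists d.
Qed.

Lemma mul2_catl (t t' u : H2 K) : mul2 (t ++ t') u = mul2 t u ++ mul2 t' u.
Proof. by rewrite /Defs.mul2 allpairs_cat flatten_cat. Qed.

Lemma mul2_cons (a a' e e' : K) i i' j j' k k' u :
  mulb i j = [:: (e, k)] -> mulb i' j' = [:: (e', k')] ->
  mul2 [:: (a, (i, i'))] ((a', (j, j')) :: u) =
  (a * a' * e * e', (k, k')) :: mul2 [:: (a, (i, i'))] u.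
Proof. by move=> H H'; rewrite /Defs.mul2 /= H H' /=. Qed.

Lemma mul2_1 (a a' : K) r z l s y m r' z' l' s' y' m' : (l + l' < n)%N -> (m + m' < n)%N ->
  mul2 [:: (a, (pbw r z l, pbw s y m))] [:: (a', (pbw r' z' l', pbw s' y' m'))] =
  [:: (a * a' * gam ^ (l%:Z * z') * gam ^ (m%:Z * y'),
      (pbw (r + r') (z + z') (l + l'), pbw (s + s') (y + y') (m + m')))].
Proof. by move=> ln mn; rewrite (mul2_cons _ _ _ (mulbE _ _ _ _ ln) (mulbE _ _ _ _ mn)). Qed.

Lemma tens1 (c d : K) i j : tens [:: (c, i)] [:: (d, j)] = [:: (c * d, (i, j))].
Proof. by []. Qed.

Lemma one2E : one2 K n w = [:: (1, (pbw 0 0 0, pbw 0 0 0))].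
Proof. by rewrite /one2 honeE /tens /= mulr1. Qed.

Lemma pow2S t k : pow2 t k.+1 = mul2 t (pow2 t k).
Proof. by []. Qed.

Lemma pow2_0 t : pow2 t 0 = [:: (1, (pbw 0 0 0, pbw 0 0 0))].
Proof. exact: one2E. Qed.

Lemma pow2E r z k :
  pow2 [:: (1, (pbw r z 0, pbw r z 0))] k = [:: (1, (pbw (r *~ k) (z *~ k) 0, pbw (r *~ k) (z *~ k) 0))].
Proof.
elim: k => [|k IHk]; first by rewrite pow2_0 !mulr0z.
rewrite pow2S IHk mul2_1 // mul0r expr0z !mulr1.
by rewrite -!pmulrn !mulrS.
Qed.

Lemma zpow2E r r' k : r' = - r ->
  zpow2 n w gam [:: (1, (pbw r 0 0, pbw r 0 0))] [:: (1, (pbw r' 0 0, pbw r' 0 0))] k =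
  [:: (1, (pbw (r * k) 0 0, pbw (r * k) 0 0))].
Proof.
move=> ->; case: k => k; rewrite /zpow2 pow2E mul0rz.
  by rewrite -!mulrzz.
by rewrite !mulNrz !NegzE !mulrN -!mulrzz.
Qed.

Lemma DeltaBE r (a l : nat) :
  DeltaB n w gam (r, a, l) =
  mul2 [:: (1, (pbw r a 0, pbw r a 0))]
     (pow2 (tens Ye (@Ge K n w) ++ tens (@hone K n w) Ye) l).
Proof.
rewrite /DeltaB XeE XinvE GeE !tens1 !mulr1 zpow2E // pow2E !mul0rz mul2_1 //.
by rewrite intz mul0r expr0z !mulr1 mul1r addr0 add0r.
Qed.

Lemma DeltaB_reduced k p : p \in DeltaB n w gam k -> reduced n p.2.1 && reduced n p.2.2.
Proof.
case: k => [[r a] l]; rewrite DeltaBE => /mem_mul2[x [y [c _ [d [cm dm] ->]]]].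
by rewrite (mem_mulb cm) (mem_mulb dm).
Qed.

(** In the expansion of (y (x) g + 1 (x) y)^l only the product of all the y (x) g reaches y-degree l
    in the first leg. *)
Lemma pow2_degree l : (l < n)%N -> exists2 u,
  pow2 (tens Ye (@Ge K n w) ++ tens (@hone K n w) Ye) l = (1, (pbw 0 0 l, pbw 0 l 0)) :: u
  & forall p, p \in u -> (p.2.1.2 < l)%N.
Proof.
elim: l => [|l IHl] ln.
  by exists [::] => //; rewrite pow2_0.
have [u Hu Hd] := IHl (ltnW ln); have n1 : (1 < n)%N by lia.
rewrite pow2S Hu YeE // GeE honeE !tens1 mulr1.
rewrite mul2_catl.
rewrite (mul2_cons _ _ _ (mulbE _ _ _ _ _) (mulbE _ _ _ _ _)) //.
eexists; first by rewrite !mulr0 mul0r !expr0z !mulr1 !add0r add1n -intS.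
move=> p; rewrite mem_cat => /orP[] /mem_mul2[x [y [c [xt yu] [d [cm _] ->]]]].
  move: xt cm; rewrite inE => /eqP -> cm.
  have yd := Hd _ yu; have ln' : (1 + y.2.1.2 < n)%N := leq_ltn_trans yd (ltnW ln).
  by rewrite (@mem_mulb_degree (pbw 0 0 1) _ _ ln' cm).
move: xt cm; rewrite inE => /eqP -> cm.
have yl : (y.2.1.2 <= l)%N by move: yu; rewrite inE => /orP[/eqP -> //|/Hd/ltnW].
have ln' : (0 + y.2.1.2 < n)%N := leq_ltn_trans yl (ltnW ln).
by rewrite (@mem_mulb_degree (pbw 0 0 0) _ _ ln' cm).
Qed.

Lemma DeltaB_degree r (a l : nat) : (a < n)%N -> (l < n)%N -> exists2 u,
  DeltaB n w gam (r, a, l) = (1, (pbw r a l, pbw r (a + l)%N 0)) :: u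
  & forall p, p \in u -> (p.2.1.2 < l)%N.
Proof.
move=> an ln; rewrite DeltaBE; have [u -> Hu] := pow2_degree ln.
rewrite (mul2_cons _ _ _ (mulbE _ _ _ _ _) (mulbE _ _ _ _ _)) //.
eexists; first by rewrite !mul0r !expr0z !mulr1 !addr0 add0n PoszD.
move=> p /mem_mul2[x [y [c [xt yu] [d [cm _] ->]]]].
move: xt cm; rewrite inE => /eqP -> cm.
have yd := Hu _ yu; have ln' : (0 + y.2.1.2 < n)%N := ltn_trans yd ln.
by rewrite (@mem_mulb_degree (pbw r a 0) _ _ ln' cm).
Qed.

(** Only the leading term of the comultiplication of [k] has a first leg of y-degree at least that
    of [k]. This isolates a component of top degree in the coassociativity axiom. *)
Lemma Dcoef_degree (k i j : idx) : reduced n k -> (k.2 <= i.2)%N ->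
  Dcoef n w gam k i j = ((k == i) && (j == pbw k.1.1 (k.1.2 + k.2)%N 0))%:R.
Proof.
case: k => [[r a] l] /andP[/= an ln] li.
rewrite /Dcoef; have [u -> Hu] := DeltaB_degree r an ln.
rewrite big_cons big_seq_cond big1 => [|p /andP[/Hu pl /eqP pij]]; last first.
  by move: pl; rewrite pij /=; lia.
rewrite addr0 /= xpair_eqE pbw_nat // [j == _]eq_sym.
by case: ifP.
Qed.

Lemma DeltaB_group r (a : nat) : (a < n)%N ->
  DeltaB n w gam (pbw r a 0) = [:: (1, (pbw r a 0, pbw r a 0))].
Proof.
by move=> an; rewrite {1}pbw_nat // DeltaBE pow2_0 mul2_1 // mul0r expr0z !mulr1 !addr0.
Qed.

Lemma DeltaB_y : (1 < n)%N -> DeltaB n w gam (pbw 0 0 1) =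
  [:: (1, (pbw 0 0 1, pbw 0 1 0)); (1, (pbw 0 0 0, pbw 0 0 1))].
Proof.
move=> n1; rewrite {1}pbw_nat // DeltaBE YeE // GeE honeE !tens1 mulr1 pow2S pow2_0.
rewrite mul2_catl !mul2_1 //= (mul2_cons _ _ _ (mulbE _ _ _ _ _) (mulbE _ _ _ _ _)) //.
by rewrite mul2_1 //= !mulr0 !mul0r !expr0z !mulr1 !addr0 !add0r.
Qed.

Lemma Delta2B_group r (a : nat) : (a < n)%N ->
  Delta2B n w gam (pbw r a 0) = [:: (1, (pbw r a 0, pbw r a 0, pbw r a 0))].
Proof. by move=> an; rewrite /Delta2B DeltaB_group // [LHS]/= cats0 DeltaB_group //= mulr1. Qed.

Lemma Delta2B_y : (1 < n)%N -> Delta2B n w gam (pbw 0 0 1) =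
  [:: (1, (pbw 0 0 1, pbw 0 1 0, pbw 0 1 0)); (1, (pbw 0 0 0, pbw 0 0 1, pbw 0 1 0));
      (1, (pbw 0 0 0, pbw 0 0 0, pbw 0 0 1))].
Proof.
have D1 : DeltaB n w gam (pbw 0 0 0) = [:: (1, (pbw 0 0 0, pbw 0 0 0))] := DeltaB_group 0 n_gt0.
by move=> n1; rewrite /Delta2B DeltaB_y //= DeltaB_y // D1 /= !mulr1.
Qed.

Lemma Delta2B_reduced k t : t \in Delta2B n w gam k -> reduced n t.2.1.2.
Proof.
case/flattenP => s /mapP[p pk ->] /mapP[x xp ->] /=.
by case/andP: (DeltaB_reduced xp).
Qed.

Lemma Sb_group r (a : nat) : (a < n)%N -> Sb n w gam (pbw r a 0) = [:: (1, pbw (- r) (- a%:Z) 0)].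
Proof.
move=> an; rewrite pbw_nat // /Sb XinvE XeE GinvE hpowE hzpowE ?opprK ?oppr0 //.
rewrite [hpow _ _ _ _ 0]honeE !hmulE // !mul0r !expr0z !mulr1 mul0rz add0r !addr0 !add0r.
by rewrite mulN1r mulNrz intz.
Qed.

Lemma Sb_y : (1 < n)%N -> Sb n w gam (pbw 0 0 1) = SY.
Proof.
move=> n1; rewrite pbw_nat // /Sb.
rewrite -[hpow n w gam SY 1]/(hmul SY (@hone K n w)) -[hpow _ _ _ _ 0]/(@hone K n w).
rewrite -[hzpow _ _ _ _ _ _]/(@hone K n w) honeE SYE // !hmulE //.
by rewrite !mulr0 !expr0z !mulr1 !addr0 !addn0.
Qed.

(** * Coefficients of products and of the recursion *)

Lemma mem_hmul (h1 h2 : Hf K) p : p \in hmul h1 h2 -> reduced n p.2.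
Proof.
by case/flattenP => s /allpairsP[[x y] /= [_ _ ->]] /mapP[c /mem_mulb cr ->].
Qed.

Lemma cc_reduced bet r i k l p : p \in cc n w gam bet r i k l -> reduced n p.2.
Proof.
have Hs c h1 h2 x : x \in hscale c (hmul h1 h2) -> reduced n x.2.
  by case/mapP => y /mem_hmul yr ->.
case: k => [|k] /=; first by case: ifP => // _ /mem_hmul.
case: ifP => _; first by rewrite mem_cat => /orP[/mem_hmul|/Hs].
case: ifP => _; last by case: ifP => // _ /mem_hmul.
by rewrite !mem_cat => /or3P[/mem_hmul|/Hs|/mem_hmul].
Qed.

Lemma hcoef_nonreduced (h : Hf K) m :
  (forall p, p \in h -> reduced n p.2) -> ~~ reduced n m -> hcoef h m = 0.
Proof.
move=> hr mr; rewrite /hcoef big_seq_cond big1 // => p /andP[/hr pr /eqP pm].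
by rewrite pm (negPf mr) in pr.
Qed.

Lemma hmul_sum (h1 h2 : Hf K) (F : idx -> K) :
  \sum_(a <- hmul h1 h2) a.1 * F a.2 =
  \sum_(p <- h1) \sum_(x <- h2) p.1 * x.1 * (\sum_(c <- mulb p.2 x.2) c.1 * F c.2).
Proof.
rewrite /Defs.hmul big_flatten big_allpairs_dep.
apply: eq_bigr => p _; apply: eq_bigr => x _.
by rewrite big_map mulr_sumr; apply: eq_bigr => c _; rewrite -!mulrA.
Qed.

(** Bilinearity of the product: it turns the sum in the Yetter-Drinfeld condition into the
    coefficient of a product with [c]. *)
Lemma hcoef_hmul_mid (h h' c : Hf K) m :
  \sum_(x <- c) x.1 * hcoef (hmul (hmul h (be K x.2)) h') m = hcoef (hmul (hmul h c) h') m.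
Proof.
rewrite hcoef_hmul (hmul_sum _ _ (fun i => \sum_(y <- h') y.1 * hcoef (mulb i y.2) m)).
rewrite exchange_big; apply: eq_bigr => x _ /=.
rewrite hcoef_hmul (hmul_sum _ _ (fun i => \sum_(y <- h') y.1 * hcoef (mulb i y.2) m)).
rewrite mulr_sumr; apply: eq_bigr => p _.
by rewrite big_seq1 /= mulr1 mulrCA mulrA.
Qed.

Lemma heq_mul1 (c : Hf K) : (forall p, p \in c -> reduced n p.2) ->
  heq (hmul (be K (pbw 0 0 0)) c) c.
Proof.
move=> cr m; rewrite hcoef_hmul big_seq1 mul1r hcoefE /=.
apply: eq_big_seq => p /cr pr; congr (_ * _).
case/andP: (pr) => _ p2; rewrite (pbw_reduced pr). rewrite mulbE //.
by rewrite hcoef1 mul0r expr0z mul1r !add0r.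
Qed.

(** One formula for all cases of the recursion: the summands omitted for large l involve an empty
    c(k,l) with l > k, and the [match] handles l = 0. *)
Lemma hcoef_ccS bet r i k l m :
  hcoef (cc n w gam bet r i k.+1 l) m =
  hcoef (hmul (cc n w gam bet r i k l) SY) m +
  bet * (gam ^+ l)^-1 * hcoef (hmul (hmul Ye (cc n w gam bet r i k l)) Ginv) m +
  (if l is l'.+1 then hcoef (hmul (cc n w gam bet r i k l') Ginv) m else 0).
Proof.
have h0 h : hcoef (hmul [::] h) m = 0 by rewrite hcoef_hmul big_nil.
case: l => [|l].
  by rewrite /= hcoef_cat hcoef_scale expr0 invr1 mulr1 addr0.
case: (ltnP l k) => lk.
  by rewrite /= ltnS lk !hcoef_cat hcoef_scale addrA.
rewrite [cc n w gam bet r i k l.+1]cc_gt // h0.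
have -> : hmul Ye [::] = [::].
  by rewrite /Defs.hmul; elim: (Ye).
rewrite h0 mulr0 !add0r /= ltnS ltnNge lk /=; case: eqP => [[->]//|/eqP lk'].
have kl : (k < l)%N by lia.
by rewrite (cc_gt _ _ _ kl) h0.
Qed.

(** * The dimension of the standard modules *)

Lemma gam_expz_eq1 (z : int) : (gam ^ z == 1) = (z %% n == 0)%Z.
Proof.
have := gam_exp_mod 1 z; rewrite mul1n mul1r => <-.
rewrite -(prim_order_dvd gam_prim) -absz_eq0.
apply/idP/idP => [|/eqP->]; last exact: dvdn0.
by rewrite /dvdn modn_small // -ltz_nat absz_mod ltz_pmod.
Qed.

Lemma mul_gam_exp bet (i : int) k : bet * gam ^ i * (gam^-1) ^+ k = bet * gam ^ (i - k%:Z).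
Proof. by rewrite expfzDr ?gam_neq0 // mulrA -exprz_inv. Qed.

(** If bet = gam^j, then m is the residue of i + j modulo n and b q^k = gam^(m-k) for b = bet gam^i,
    which is first 1 at k = m. If bet is no power of gam, then m = n - 1, and b q^k = 1 is
    impossible, as it would give bet^n = 1. *)
Lemma mdimP (bet : K) (i : int) (m := mdim n gam bet i) :
  [/\ (m < n)%N, (forall k, (k < m)%N -> bet * gam ^ i * (gam^-1) ^+ k != 1)
    & (m.+1 < n)%N -> bet * gam ^ i * (gam^-1) ^+ m = 1 /\ bet ^+ n = 1].
Proof.
rewrite /m /mdim; case: pickP => [j /eqP -> | nopow]; last first.
  split; [by rewrite prednK| |by rewrite prednK // ltnn].
  move=> k _; apply/eqP; rewrite mul_gam_exp => bk.
  have : bet ^+ n = 1.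
    have := congr1 (fun x => x ^+ n) bk; rewrite exprMn expr1n.
    rewrite -[(gam ^ _) ^+ n]/((gam ^ _) ^ n%:Z) exprz_exp [_ * n%:Z]mulrC -(exprz_exp _ n%:Z).
    by rewrite (prim_expr_order gam_prim : gam ^ n%:Z = 1) exp1rz mulr1.
  by case/(prim_rootP gam_prim) => j bj; have := nopow j; rewrite bj eqxx.
rewrite /phi; set t := absz _.
have tE : t%:Z = ((- i - j%:Z - 1) %% n)%Z by rewrite absz_mod.
have tn : (t < n)%N by rewrite -ltz_nat tE ltz_pmod.
have := divz_eq (- i - j%:Z - 1) n; rewrite -tE.
move: (_ %/ _)%Z => d dE.
(* As t + 1 = phi(-i-j), the division with quotient [d] shows that m is congruent to i + j modulo
   n. *)
have mE : (n - t.+1)%N%:Z = i + j%:Z + (d + 1) * n%:Z by rewrite mulrDl; lia.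
have gE k : gam ^+ j * gam ^ i * gam^-1 ^+ k = gam ^ ((n - t.+1)%N%:Z - k%:Z).
  rewrite mul_gam_exp -[gam ^+ j]/(gam ^ j%:Z) -expfzDr ?gam_neq0 //.
  apply: (mulIf (expfz_neq0 (k%:Z - i - j%:Z) gam_neq0)); rewrite -!expfzDr ?gam_neq0 //.
  rewrite mE (_ : _ + _ = 0); last by ring.
  rewrite (_ : _ + _ = (d + 1) * n%:Z); last by ring.
  rewrite mulrC -(exprz_exp _ n%:Z).
  by have -> : gam ^ n%:Z = 1 := prim_expr_order gam_prim; rewrite exp1rz.
split; first lia.
  move=> k km; rewrite gE gam_expz_eq1 subzn 1?ltnW // modz_nat eqz_nat modn_small; lia.
by move=> _; rewrite gE subrr expr0z exprAC (prim_expr_order gam_prim) expr1n.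
Qed.

(* [Vrho] and [Vdelta] with the dimension as a free parameter, so that equal
   values of [mdim] can be substituted. *)
Section GenericDimension.
Variables (m : nat) (al bet : K).

Definition Gop_dim (v : 'rV[K]_m.+1) : 'rV[K]_m.+1 :=
  \row_(k < m.+1) (bet * (gam ^+ k)^-1 * v 0 k).
Definition Yop_dim (v : 'rV[K]_m.+1) : 'rV[K]_m.+1 :=
  \row_(k < m.+1) (if k == ord0 then (1 - bet ^+ n) * v 0 ord_max else v 0 (inord k.-1)).
Definition Vrho_dim (j : idx) (v : 'rV[K]_m.+1) : 'rV[K]_m.+1 :=
  let: (r', a, l) := j in al ^ r' *: iter a Gop_dim (iter l Yop_dim v).
Definition Vdelta_dim (C : nat -> nat -> Hf K) (v : 'rV[K]_m.+1) : seq (idx * 'rV[K]_m.+1) :=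
  flatten [seq [seq (p.2, (v 0 k * p.1) *: delta_mx 0 l) | p <- C k l]
          | k <- enum 'I_m.+1, l <- enum 'I_m.+1].

Lemma dcomp_Vdelta_dim C u j :
  dcomp (Vdelta_dim C) u j =
  \sum_(k < m.+1) \sum_(l < m.+1) (u 0 k * hcoef (C k l) j) *: delta_mx 0 l.
Proof.
rewrite /dcomp /Vdelta_dim big_flatten big_allpairs_dep big_enum.
apply: eq_bigr => k _; rewrite big_enum; apply: eq_bigr => l _.
rewrite big_map /hcoef mulr_sumr scaler_suml.
by apply: eq_bigr.
Qed.
End GenericDimension.

Lemma dcomp_Vdelta (bet : K) (r i : int) u j :
  dcomp (@Vdelta K n w gam bet r i) u j =
  \sum_(k < (mdim n gam bet i).+1) \sum_(l < (mdim n gam bet i).+1)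
     (u 0 k * hcoef (cc n w gam bet r i k l) j) *: delta_mx 0 l.
Proof. exact: dcomp_Vdelta_dim. Qed.

(** A shift by [d] along g^n = x^w changes the exponent of x by w d, so equal exponents of x force d
    = 0. *)
Lemma eq_pbw_shift (r z : int) (k k' l : nat) : (0 < w)%N ->
  (pbw r (z - k'%:Z) l == pbw r (z - k%:Z) k) = (k' == k) && (l == k).
Proof.
move=> w0; rewrite eq_pbw; congr (_ && _); apply/eqP/eqP => [|->//].
case/pbw_inj => d zd rd.
have : w%:Z * d = 0 by apply: (addrI r); rewrite -rd addr0.
move=> /eqP; rewrite mulf_eq0 => /orP[/eqP|/eqP d0]; first lia.
by move: zd; rewrite d0 mul0r addr0; lia.
Qed.

(** The g-exponent of x^r g^(i-k) y^k determines k' = k, and then the y-degree forces l = 0: this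
    monomial is a marker for c(k,0). *)
Lemma hcoef_cc_bot (bet : K) (r i : int) k k' l : (0 < w)%N -> (k < n)%N -> (k' < n)%N -> (l <= k')%N ->
  hcoef (cc n w gam bet r i k' l) (pbw r (i - k%:Z) k) =
  if (k' == k) && (l == 0)%N then ccoef (bet * gam ^ i) k 0 else 0.
Proof.
move=> w_gt0 kn kn' lk; rewrite (ccE _ _ _ kn' lk) hcoef1 eq_pbw_shift //.
case: eqP lk => [->|_] lk; last by rewrite mulr0.
have -> : (k - l == k)%N = (l == 0)%N by lia.
by case: eqP => [->|_]; rewrite ?mulr1 ?mulr0.
Qed.

Lemma ccoef0_neq0 (bet : K) (i : int) k : (k <= mdim n gam bet i)%N -> ccoef (bet * gam ^ i) k 0 != 0.
Proof.
move=> km; have [_ bm _] := mdimP bet i.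
rewrite /ccoef mulf_neq0 ?theta0_neq0 ?invr_eq0 ?gam_neq0 //.
rewrite prodf_seq_neq0; apply/allP => s; rewrite mem_index_iota => /andP[_ sk].
by rewrite subr_eq0 bm // (leq_trans sk).
Qed.

(** The factor of the product at s = m vanishes. *)
Lemma ccoef_eq0 (bet : K) (i : int) l (m := mdim n gam bet i) :
  (l <= m)%N -> (m.+1 < n)%N -> ccoef (bet * gam ^ i) m.+1 l = 0.
Proof.
move=> lm mn; have [_ _ /(_ mn) [bm _]] := mdimP bet i.
by rewrite /ccoef big_nat_recr //= bm subrr !mulr0.
Qed.

(** * Yetter-Drinfeld modules *)

Section YDModule.
Variables (V : lmodType K) (rho : idx -> V -> V) (delta : V -> seq (idx * V)).
Hypothesis YD : isYD n w gam rho delta.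

Local Notation dcomp := (dcomp delta).

Lemma rho_lin i a u v : rho i (a *: u + v) = a *: rho i u + rho i v.
Proof. by case: YD => H _; apply: H. Qed.

Lemma rho1 v : rho (pbw 0 0 0) v = v.
Proof. by case: YD => _ [/(_ v) H _]; rewrite -{2}H honeE /actH big_seq1 scale1r. Qed.

Lemma rhoM i j v : reduced n i -> reduced n j -> rho i (rho j v) = actH rho (mulb i j) v.
Proof. by case: YD => _ [_ [H _]]; apply: H. Qed.

Lemma rhoME r z l r' z' l' v : (l + l' < n)%N ->
  rho (pbw r z l) (rho (pbw r' z' l') v) = gam ^ (l%:Z * z') *: rho (pbw (r + r') (z + z') (l + l')) v.
Proof. by move=> ln; rewrite rhoM ?reduced_pbw ?mulbE ?/actH ?big_seq1 //; lia. Qed.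

Lemma delta_reduced v p : p \in delta v -> reduced n p.1.
Proof. by case: YD => _ [_ [_ [/(_ v) /allP H _]]]; apply: H. Qed.

Lemma dcomp_lin i a u v : dcomp (a *: u + v) i = a *: dcomp u i + dcomp v i.
Proof. by case: YD => _ [_ [_ [_ [H _]]]]; apply: H. Qed.

Lemma counit v : \sum_(p <- delta v) epsb K p.1 *: p.2 = v.
Proof. by case: YD => _ [_ [_ [_ [_ [H _]]]]]; apply: H. Qed.

Lemma coassoc v i j : reduced n i -> reduced n j ->
  \sum_(p <- delta v) Dcoef n w gam p.1 i j *: p.2 = dcomp (dcomp v i) j.
Proof.
case: YD => _ [_ [_ [_ [_ [_ [H _]]]]]] ri rj; rewrite H //.
by rewrite {3}/Defs.dcomp (op_sum (dcomp_lin j)).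
Qed.

Lemma YD_compat k v m : reduced n k -> reduced n m ->
  dcomp (rho k v) m = \sum_(t <- Delta2B n w gam k) \sum_(p <- delta v)
    (t.1 * hcoef (hmul (hmul (be K t.2.1.1) (be K p.1)) (Sb n w gam t.2.2)) m) *: rho t.2.1.2 p.2.
Proof. by case: YD => _ [_ [_ [_ [_ [_ [_ H]]]]]]; apply: H. Qed.

Lemma dcomp_nonreduced v m : ~~ reduced n m -> dcomp v m = 0.
Proof.
move=> mr; rewrite /Defs.dcomp big_seq_cond big1 // => p /andP[/delta_reduced pr /eqP pm].
by rewrite pm (negPf mr) in pr.
Qed.

Lemma delta_sum (W : zmodType) (F : idx -> V -> W) v s :
  (forall i, F i 0 = 0) -> (forall i, {morph F i : u v / u + v}) ->
  uniq s -> {subset [seq p.1 | p <- delta v] <= s} ->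
  \sum_(p <- delta v) F p.1 p.2 = \sum_(i <- s) F i (dcomp v i).
Proof. exact: fsum_undup. Qed.

Lemma delta_scale_sum (F : idx -> K) (T : V -> V) v s :
  (forall a u u', T (a *: u + u') = a *: T u + T u') ->
  uniq s -> {subset [seq p.1 | p <- delta v] <= s} ->
  \sum_(p <- delta v) F p.1 *: T p.2 = \sum_(i <- s) F i *: T (dcomp v i).
Proof.
move=> TL; apply: (@delta_sum _ (fun i u => F i *: T u)) => i.
  by rewrite (op0 TL) scaler0.
by move=> u u'; rewrite (opD TL) scalerDr.
Qed.

(** Allows a closed form of the coaction of [v] to replace the arbitrary list [delta v] inside
    linear expressions. *)
Lemma delta_repr (F : idx -> K) (T : V -> V) v N (C : 'I_N -> Hf K) (u : 'I_N -> V) :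
  (forall a u u', T (a *: u + u') = a *: T u + T u') ->
  (forall m, dcomp v m = \sum_k hcoef (C k) m *: u k) ->
  \sum_(p <- delta v) F p.1 *: T p.2 =
  \sum_k (\sum_(x <- C k) x.1 * F x.2) *: T (u k).
Proof.
move=> TL H; pose h := flatten [seq [seq (x.2, x.1 *: u k) | x <- C k] | k <- enum 'I_N].
rewrite (@eq_fsum _ _ _ (fun i x => F i *: T x) _ h).
- rewrite big_flatten big_map big_enum; apply: eq_bigr => k _.
  rewrite big_map scaler_suml; apply: eq_bigr => x _ /=.
  by rewrite (opZ TL) scalerA mulrC.
- by move=> i; rewrite (op0 TL) scaler0.
- by move=> i x y; rewrite (opD TL) scalerDr.
move=> i; rewrite -/(dcomp v i) H big_flatten big_map big_enum.
apply: eq_bigr => k _; rewrite big_map /hcoef scaler_suml.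
by apply: eq_bigr.
Qed.

(** * The coaction after acting by group-likes and by y *)

(** A group-like acts on the first leg by conjugation, and conjugation by x^r g^a multiplies y^l by
    gam^(-al). *)
Lemma dcomp_group r (a : nat) v m : (a < n)%N ->
  dcomp (rho (pbw r a 0) v) m = gam ^ (m.2%:Z * - a%:Z) *: rho (pbw r a 0) (dcomp v m).
Proof.
move=> an; case: (boolP (reduced n m)) => mr; last first.
  by rewrite !dcomp_nonreduced // (op0 (rho_lin _)) scaler0.
rewrite YD_compat ?reduced_pbw // Delta2B_group // big_seq1 /= Sb_group //.
rewrite [dcomp v m]/Defs.dcomp (op_sum (rho_lin _)) scaler_sumr [RHS]big_mkcond.
apply: eq_big_seq => p /delta_reduced pr.
case/andP: (pr) => _ p2; rewrite (pbw_reduced pr) /be !hmulE // ?addn0 //.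
rewrite hcoef1 (mul0r p.1.1.2%:Z) expr0z !mul1r add0n.
have -> : r + p.1.1.1 - r = p.1.1.1 by rewrite addrAC addrN add0r.
have -> : a%:Z + p.1.1.2%:Z - a%:Z = p.1.1.2 by rewrite addrAC addrN add0r.
rewrite -(pbw_reduced pr); case: eqP => [<-|_]; last by rewrite mulr0 scale0r.
by rewrite mulr1.
Qed.

(** The terms y (x) g (x) g, 1 (x) y (x) g and 1 (x) 1 (x) y of the iterated comultiplication give
    the three summands, the same as in the recursion for c(k,l). *)
Lemma dcomp_y v m N (C : 'I_N -> Hf K) (u : 'I_N -> V) : (1 < n)%N ->
  (forall k p, p \in C k -> reduced n p.2) ->
  (forall m, dcomp v m = \sum_k hcoef (C k) m *: u k) ->
  dcomp (rho (pbw 0 0 1) v) m = \sum_k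
    (hcoef (hmul (hmul Ye (C k)) Ginv) m *: rho (pbw 0 1 0) (u k) +
     hcoef (hmul (C k) Ginv) m *: rho (pbw 0 0 1) (u k) +
     hcoef (hmul (C k) SY) m *: u k).
Proof.
move=> n1 Cr H; case: (boolP (reduced n m)) => mr; last first.
  rewrite dcomp_nonreduced // big1 // => k _.
  by rewrite !(@hcoef_nonreduced (hmul _ _)) ?scale0r ?addr0 // => p /mem_hmul.
rewrite YD_compat ?reduced_pbw // Delta2B_y // !big_cons big_nil addr0 /=.
have SG : Sb n w gam (pbw 0 1 0) = [:: (1, pbw 0 (-1) 0)] := Sb_group 0 n1.
rewrite Sb_y // SG.
have L F k := @delta_repr (fun i => 1 * F i) (rho k) v N C u (rho_lin k) H.
rewrite (L (fun i => hcoef (hmul (hmul (be K (pbw 0 0 1)) (be K i)) [:: (1, pbw 0 (-1) 0)]) m)).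
rewrite (L (fun i => hcoef (hmul (hmul (be K (pbw 0 0 0)) (be K i)) [:: (1, pbw 0 (-1) 0)]) m)).
rewrite (L (fun i => hcoef (hmul (hmul (be K (pbw 0 0 0)) (be K i)) SY) m)).
rewrite -!big_split /=; apply: eq_bigr => k _; rewrite addrA.
congr (_ *: _ + _ *: _ + _ *: _); last by rewrite rho1.
- under eq_bigr do rewrite mul1r.
  by rewrite hcoef_hmul_mid YeE // GinvE.
- under eq_bigr do rewrite mul1r.
  by rewrite hcoef_hmul_mid (heq_hmul (heq_mul1 (Cr k)) (fun=> erefl)) GinvE.
under eq_bigr do rewrite mul1r.
by rewrite hcoef_hmul_mid (heq_hmul (heq_mul1 (Cr k)) (fun=> erefl)).
Qed.

(** * Group-like vectors and the submodules they generate *)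

(** For a component of maximal y-degree, [coassoc] and [Dcoef_degree] leave only that component
    itself in its coaction. *)
Lemma exists_grouplike : (exists v : V, v != 0) ->
  exists (r : int) (a : nat) (v : V),
    [/\ (a < n)%N, v != 0 & forall i, dcomp v i = (i == pbw r a 0)%:R *: v].
Proof.
case=> v v0; set s := undup [seq p.1 | p <- delta v].
have us : uniq s by apply: undup_uniq.
have vs : {subset [seq p.1 | p <- delta v] <= s} by move=> i; rewrite mem_undup.
have sr i : i \in s -> reduced n i.
  by rewrite mem_undup => /mapP[p /delta_reduced pr ->].
pose P l := has (fun i => (dcomp v i != 0) && (i.2 == l)) s.
have exP : exists l, P l.
  have : has (fun i => dcomp v i != 0) s.
    (* By the counit axiom a vector without nonzero components is zero. *)
    apply/negPn; apply: contra_neqN v0 => /hasPn vz.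
    rewrite -(counit v) (@delta_scale_sum (epsb K) id v s) //.
    by rewrite big_seq big1 // => i /vz /negPn/eqP ->; rewrite scaler0.
  by case/hasP => i si vi; exists i.2; apply/hasP; exists i; rewrite ?vi ?eqxx.
have ubP l : P l -> (l <= n)%N.
  by case/hasP => i /sr /andP[_ i2] /andP[_ /eqP <-]; apply: ltnW.
case: (ex_maxnP exP ubP) => l /hasP[i si /andP[vi /eqP il]] lmax.
have ri := sr _ si; case/andP: (ri) => i1 i2.
(* The second leg of the leading term is x^r g^(a+l); its exponent a + l may reach n and must be
   reduced. *)
pose z : int := (i.1.2 + i.2)%N.
exists (i.1.1 + w%:Z * (z %/ n)%Z), `|(z %% n)%Z|%N, (dcomp v i).
have EE : pbw (i.1.1 + w%:Z * (z %/ n)%Z) `|(z %% n)%Z|%N 0 = pbw i.1.1 z 0.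
  by rewrite pbw_shift absz_mod addrC -divz_eq.
split=> // [|j]; first by have := reduced_pbw i.1.1 z 0; rewrite n_gt0 => /andP[].
rewrite EE; case: (boolP (reduced n j)) => rj; last first.
  rewrite dcomp_nonreduced //; case: eqP => [jE|_]; last by rewrite scale0r.
  by rewrite jE reduced_pbw n_gt0 in rj.
rewrite -coassoc // (@delta_scale_sum (fun k => Dcoef n w gam k i j) id v s) //.
rewrite (bigD1_seq i) //= [X in _ + X]big_seq_cond big1 ?addr0.
  by rewrite Dcoef_degree // eqxx.
move=> k /andP[sk ki]; have [->|vk] := eqVneq (dcomp v k) 0; first by rewrite scaler0.
rewrite Dcoef_degree ?sr // ?(negPf ki) ?scale0r // il; apply: lmax.
by apply/hasP; exists k; rewrite ?vk ?eqxx.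
Qed.

Section Grouplike.
Variables (h : idx) (v : V).
Hypothesis v_group : forall i, dcomp v i = (i == h)%:R *: v.

Definition generated (x : V) : Prop :=
  exists2 C : Hf K, forall p, p \in C -> reduced n p.2 & x = actH rho C v.

Lemma generated_lin a x y : generated x -> generated y -> generated (a *: x + y).
Proof.
case=> C Cr -> [D Dr ->]; exists (hscale a C ++ D).
  by move=> p; rewrite mem_cat => /orP[/mapP[q' /Cr qr ->]|/Dr].
rewrite /actH big_cat big_map scaler_sumr; congr (_ + _).
by apply: eq_bigr => p _; rewrite scalerA.
Qed.

Lemma generated0 : generated 0.
Proof. by exists [::] => //; rewrite /actH big_nil. Qed.

Lemma generatedZ a x : generated x -> generated (a *: x).
Proof. by move=> gx; rewrite -[_ *: _]addr0; apply: generated_lin => //; apply: generated0. Qed.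

Lemma generated_sum (I : eqType) (s : seq I) (F : I -> V) :
  (forall i, i \in s -> generated (F i)) -> generated (\sum_(i <- s) F i).
Proof.
move=> gF; rewrite big_seq; apply: big_ind => //; first exact: generated0.
by move=> x y gx gy; rewrite -[x]scale1r; apply: generated_lin.
Qed.

Lemma generated_rho k : reduced n k -> generated (rho k v).
Proof.
move=> kr; exists (be K k); last by rewrite /actH big_seq1 scale1r.
by move=> p; rewrite inE => /eqP ->.
Qed.

(** H v is closed under the coaction because, [v] being group-like, the compatibility condition only
    lets basis elements act on multiples of [v]. *)
Lemma generated_YDsub : YDsub n rho delta generated.
Proof.
split; first exact: generated0.
split; first exact: generated_lin.
split=> [k _ kr [C Cr ->]|_ m [C Cr ->]].
  rewrite /actH (op_sum (rho_lin _)); apply: generated_sum => p /Cr pr.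
  rewrite (opZ (rho_lin _)) rhoM //; apply: generatedZ.
  by apply: generated_sum => c /mem_mulb cr; apply/generatedZ/generated_rho.
rewrite /actH (op_sum (dcomp_lin _)); apply: generated_sum => p /Cr pr.
rewrite (opZ (dcomp_lin _)); apply: generatedZ.
case: (boolP (reduced n m)) => mr; last by rewrite dcomp_nonreduced //; apply: generated0.
rewrite YD_compat //; apply: generated_sum => t /Delta2B_reduced tr.
set s := undup [seq p.1 | p <- delta v].
rewrite (@delta_scale_sum (fun i => t.1 * hcoef (hmul (hmul (be K t.2.1.1) (be K i)) (Sb n w gam t.2.2)) m) (rho t.2.1.2) v s).
- apply: generated_sum => i _; rewrite v_group (opZ (rho_lin _)).
  by do 2![apply: generatedZ]; apply: generated_rho.
- exact: rho_lin.
- exact: undup_uniq.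
- by move=> i; rewrite mem_undup.
Qed.
End Grouplike.

Lemma generated_all h v : simpleYD n rho delta -> v != 0 ->
  (forall i, dcomp v i = (i == h)%:R *: v) -> forall x, generated v x.
Proof.
case=> _ simpleV v0 vg; case: (simpleV _ (generated_YDsub vg)) => // H.
have r0 : reduced n (pbw 0 0 0) by rewrite reduced_pbw.
by have := H _ (generated_rho v r0); rewrite rho1 => vz; rewrite vz eqxx in v0.
Qed.

(** * The central group-like x acts by a scalar *)

Lemma rho_x_add r s u : rho (pbw r 0 0) (rho (pbw s 0 0) u) = rho (pbw (r + s) 0 0) u.
Proof. by rewrite rhoME // mul0r expr0z scale1r !addr0. Qed.

Lemma iter_x k u : iter k (rho (pbw 1 0 0)) u = rho (pbw k%:Z 0 0) u.
Proof. by elim: k => [|k IHk] /=; rewrite ?rho1 // IHk rho_x_add -intS. Qed.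

Lemma rho_x_comm k u : reduced n k -> rho k (rho (pbw 1 0 0) u) = rho (pbw 1 0 0) (rho k u).
Proof.
move=> kr; case/andP: (kr) => _ kl; rewrite (pbw_reduced kr) !rhoME ?addn0 //.
by rewrite mulr0 (mul0r k.1.2%:Z) expr0z !scale1r addr0 !add0r add0n [1 + _]addrC.
Qed.

Lemma dcomp_x u m : dcomp (rho (pbw 1 0 0) u) m = rho (pbw 1 0 0) (dcomp u m).
Proof. by rewrite (dcomp_group 1 _ _ n_gt0) mulr0 expr0z scale1r. Qed.

(** x - c commutes with the action and the coaction, so its kernel, and likewise its image, is a
    submodule. *)
Lemma ker_x_YDsub c : YDsub n rho delta (fun u => rho (pbw 1 0 0) u = c *: u).
Proof.
split; first by rewrite (op0 (rho_lin _)) scaler0.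
split; first by move=> a u v Hu Hv; rewrite rho_lin Hu Hv scalerDr !scalerA mulrC.
split=> [k v kr Hv|v i Hv]; first by rewrite -rho_x_comm // Hv (opZ (rho_lin _)).
by rewrite -dcomp_x Hv (opZ (dcomp_lin _)).
Qed.

Lemma im_x_YDsub c : YDsub n rho delta (fun u => exists u', u = rho (pbw 1 0 0) u' - c *: u').
Proof.
split; first by exists 0; rewrite (op0 (rho_lin _)) scaler0 subr0.
split=> [a _ _ [u ->] [v ->]|].
  exists (a *: u + v); rewrite rho_lin [c *: (_ + _)]scalerDr opprD addrACA scalerBr !scalerA.
  by rewrite mulrC.
split=> [k _ kr [u ->]|_ i [u ->]].
  exists (rho k u); rewrite -rho_x_comm // -[- (c *: u)]scaleNr.
  by rewrite (opD (rho_lin _)) (opZ (rho_lin _)) scaleNr.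
exists (dcomp u i); rewrite -dcomp_x -[- (c *: u)]scaleNr.
by rewrite (opD (dcomp_lin _)) (opZ (dcomp_lin _)) scaleNr.
Qed.

(* Up to a power of x, every element is a K[x]-combination of the vectors g^a y^l v. *)
Lemma generated_x h v (e := fun j : 'I_(n * n) => rho (pbw 0 (j %/ n)%N (j %% n)%N) v) :
  (forall i, dcomp v i = (i == h)%:R *: v) -> forall x, generated v x ->
  exists t (p : 'I_(n * n) -> {poly K}),
    iter t (rho (pbw 1 0 0)) x = \sum_j pact (rho (pbw 1 0 0)) (p j) (e j).
Proof.
move=> vg _ [C Cr ->]; set X := rho (pbw 1 0 0).
have Xl : forall a u u', X (a *: u + u') = a *: X u + X u' := rho_lin _.
elim: C Cr => [|[c k] C IHC] Cr.
  exists 0%N, (fun=> 0); rewrite /actH big_nil big1 //= => j _.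
  by rewrite /pact size_poly0 big_ord0.
have [|t [p Hp]] := IHC; first by move=> x xC; apply: Cr; rewrite inE xC orbT.
have /= kr := Cr (c, k) (mem_head _ _); case/andP: (kr) => k1 k2.
(* The pair (a, l) of exponents of g and y is coded as a n + l. *)
have jlt : (k.1.2 * n + k.2 < n * n)%N.
  by rewrite (leq_trans (n := k.1.2.+1 * n)) ?leq_mul2r ?k1 ?orbT // mulSn addnC ltn_add2r.
(* The exponent s = |r| + r is nonnegative: multiplying by x^|r| clears a possibly negative power
   x^r. *)
pose j0 := Ordinal jlt; pose r := k.1.1; pose s := absz (`|r|%N%:Z + r).
have rk : rho k v = rho (pbw r 0 0) (e j0).
  rewrite /e /= divnMDl // modnMDl divn_small // modn_small // addn0.
  by rewrite rhoME // (mul0r k.1.2%:Z) expr0z scale1r addr0 !add0r -pbw_reduced.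
have sE : s%:Z = `|r|%N%:Z + r by rewrite /s; lia.
(* The new term becomes c x^(t+s) e_(j0), while the tail, already cleared by x^t, gains a factor
   x^|r|. *)
exists (t + `|r|)%N, (fun j => 'X^(`|r|) * p j + (j == j0)%:R%:P * (c%:P * 'X^(t + s))).
have -> : actH rho ((c, k) :: C) v = c *: rho (pbw r 0 0) (e j0) + actH rho C v.
  by rewrite /actH big_cons /= rk.
under eq_bigr do rewrite pactD (pactM Xl) (pactXn Xl) !pactCM (pactXn Xl).
rewrite big_split /= -(iter_sum Xl) -Hp (bigD1 j0) //= [X in _ + (_ + X)]big1 => [|j /negPf ->]; last first.
  by rewrite scale0r.
rewrite eqxx scale1r addr0 (iter_lin Xl) addrC -iterD [(`|r| + t)%N]addnC; congr (_ *: _ + _).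
by rewrite !iter_x rho_x_add; congr (rho (pbw _ _ _) _); lia.
Qed.

Hypothesis K_split : forall p : {poly K},
  exists s : seq K, p = lead_coef p *: \prod_(z <- s) ('X - z%:P).

Lemma x_eigenvector h v : simpleYD n rho delta -> v != 0 ->
  (forall i, dcomp v i = (i == h)%:R *: v) ->
  exists z u, u != 0 /\ rho (pbw 1 0 0) u = z *: u.
Proof.
move=> simpleV v0 vg; set X := rho (pbw 1 0 0).
pose e (j : 'I_(n * n)) := rho (pbw 0 (j %/ n)%N (j %% n)%N) v.
have gen x : exists t (p : 'I_(n * n) -> {poly K}), iter t X x = \sum_j pact X (p j) (e j).
  by apply: (generated_x vg); apply: (generated_all simpleV v0 vg).
have Xl : forall a u u', X (a *: u + u') = a *: X u + X u' := rho_lin _.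
case: (simpleV) => _ /(_ _ (im_x_YDsub 1)) [im0|imT].
  exists 1, v; split=> //; apply/eqP; rewrite -subr_eq0; apply/eqP/im0.
  by exists v.
(* Each e_i is lifted through x - 1, and the lift is written in the e_j after multiplication by a
   power of x. *)
have {imT} H (i : 'I_(n * n)) : exists tA : nat * ('I_(n * n) -> {poly K}),
    iter tA.1 X (e i) = \sum_j pact X (('X - 1%:P) * tA.2 j) (e j).
  have [u ->] := imT (e i); have [t [A HA]] := gen u.
  exists (t, A); rewrite /= -scaleNr (op_iterD Xl) (iterZ Xl) -iterSr iterS HA.
  rewrite (op_sum Xl) scaler_sumr -big_split; apply: eq_bigr => j _ /=.
  by rewrite (pactM Xl) -polyCN pactD pactX pactC.
case/fin_all_exists: H => tA HtA.
(* The rows of [M] are relations between the e_j. At X = 1 the matrix is the identity, so its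
   determinant is a nonzero polynomial. *)
pose M := \matrix_(i, j) ((i == j)%:R%:P * 'X^((tA i).1) - ('X - 1%:P) * (tA i).2 j).
have detM : \det M != 0.
  apply: contraTneq (oner_neq0 K) => M0; rewrite negbK.
  have : horner_eval 1 (\det M) = 0 by rewrite M0 /horner_eval horner0.
  rewrite -det_map_mx (_ : map_mx _ M = 1%:M) ?det1 => [->//|].
  apply/matrixP => i j; rewrite !mxE /= /horner_eval !hornerE.
  by rewrite expr1n subrr mul0r subr0 mulr1; case: eqP.
have Me i : \sum_j pact X (M i j) (e j) = 0.
  under eq_bigr do rewrite mxE pactD pactN pactCM.
  rewrite big_split sumrN -HtA /= (bigD1 i) //= big1 => [|j ji]; last first.
    by rewrite eq_sym (negPf ji) scale0r.
  by rewrite eqxx scale1r addr0 (pactXn Xl) subrr.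
have nn0 : (0 < n * n)%N by rewrite muln_gt0 n_gt0.
have := pact_det Xl Me (Ordinal nn0).
have -> : e (Ordinal nn0) = v by rewrite /e /= div0n mod0n rho1.
have [s ->] := K_split (\det M).
rewrite -mul_polyC pactCM => /eqP; rewrite scaler_eq0 lead_coef_eq0 (negPf detM) /=.
move=> /eqP; case/(@eigenvector_of_split _ _ _ Xl (fun=> True)) => // z [u [u0 _ uE]].
by exists z, u.
Qed.

(** An eigenspace of x is a nonzero submodule, hence everything; the eigenvalue is nonzero because x
    is invertible. *)
Lemma x_scalar : simpleYD n rho delta ->
  exists2 al : K, al != 0 & forall r u, rho (pbw r 0 0) u = al ^ r *: u.
Proof.
move=> simpleV; have [V0 _] := simpleV.
have [r0 [a0 [v [_ v0 vg]]]] := exists_grouplike V0.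
have [al [u [u0 uE]]] := x_eigenvector simpleV v0 vg.
have {u u0 uE} alE u' : rho (pbw 1 0 0) u' = al *: u'.
  case: (simpleV) => _ /(_ _ (ker_x_YDsub al)) [H|]; last by apply.
  by have := H _ uE => uz; rewrite uz eqxx in u0.
have al0 : al != 0.
  apply: contraNneq v0 => al0; rewrite -(rho1 v) -(addNr 1) -rho_x_add alE al0.
  by rewrite scale0r (op0 (rho_lin _)).
have HN k u : rho (pbw k%:Z 0 0) u = al ^+ k *: u.
  by elim: k => [|k IHk]; rewrite ?rho1 ?scale1r // intS -rho_x_add alE IHk scalerA exprS.
exists al => // -[k|k] u; first exact: HN.
have := HN k.+1 (rho (pbw (Negz k) 0 0) u).
rewrite rho_x_add NegzE addrN rho1 => {2}->.
by rewrite scalerA -[al ^ _]/(al ^- k.+1) mulVf ?scale1r // expf_neq0.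
Qed.

(** * Powers of g and y, and eigenvectors of g *)

Lemma rho_g_iter k u : iter k (rho (pbw 0 1 0)) u = rho (pbw 0 k%:Z 0) u.
Proof.
elim: k => [|k IHk] /=; first by rewrite rho1.
by rewrite IHk rhoME // (mul0r k%:Z) expr0z scale1r addr0 addn0 -intS.
Qed.

Lemma rho_y_iter k u : (k < n)%N -> iter k (rho (pbw 0 0 1)) u = rho (pbw 0 0 k) u.
Proof.
elim: k => [|k IHk] kn /=; first by rewrite rho1.
by rewrite IHk ?(ltnW kn) // rhoME // mulr0 expr0z scale1r addr0 add1n.
Qed.

(** The product y y^(n-1) is where the relation for y^n applies: the binomial sum in [mono] has the
    two terms 1 and -x^w. *)
Lemma rho_y_pow u : (1 < n)%N -> iter n (rho (pbw 0 0 1)) u = u - rho (pbw w%:Z 0 0) u.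
Proof.
move=> n1; have nE : n = n.-1.+1 by lia.
rewrite {1}nE iterS rho_y_iter; last by lia.
rewrite rhoM ?reduced_pbw //; last by rewrite prednK.
rewrite !pbw_nat //.
rewrite /Defs.mulb /Defs.mono add1n -nE divnn n_gt0 modnn addn0 mod0n div0n.
rewrite /actH /= !big_cons big_nil /= !muln0 muln1 !addr0 bin0 bin1 expr0 expr1 !mulr1 !mul1r.
by rewrite scale1r scaleN1r add0r -(pbw_nat 0 0 n_gt0) rho1.
Qed.

(** The vectors with coaction in h (x) V, for a fixed group-like h, form a g-stable space, and X^n -
    al^w kills it at g because g^n = x^w. *)
Lemma exists_g_eigenvector al : (exists v : V, v != 0) ->
  (forall r u, rho (pbw r 0 0) u = al ^ r *: u) ->
  exists (bet : K) (r : int) (a : nat) (v : V),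
    [/\ bet ^+ n = al ^+ w, v != 0, (1 < n)%N -> rho (pbw 0 1 0) v = bet *: v
      & forall i, dcomp v i = (i == pbw r a 0)%:R *: v].
Proof.
move=> V0 xE; have [r [a [v [an v0 vg]]]] := exists_grouplike V0.
(* For n = 1 the index of g is not reduced; as g = x^w, the value bet = al^w is the only one
   possible. *)
case: (ltnP 1 n) => n1; last first.
  exists (al ^+ w), r, a, v; split=> //.
  by have -> : n = 1%N by lia.
set G := rho (pbw 0 1 0).
have Gl : forall c u u', G (c *: u + u') = c *: G u + G u' := rho_lin _.
have Gn u : iter n G u = al ^+ w *: u.
  rewrite rho_g_iter (_ : pbw 0 n 0 = pbw w%:Z 0 0) ?xE //.
  by rewrite -[n%:Z]add0r -[n%:Z in LHS]mul1r -pbw_shift mulr1 add0r.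
pose P u := forall i, dcomp u i = (i == pbw r a 0)%:R *: u.
have [s sE] := K_split ('X^n - (al ^+ w)%:P).
have sz : lead_coef ('X^n - (al ^+ w)%:P) = 1 by rewrite lead_coefXnsubC.
have := @eigenvector_of_split _ _ _ Gl P s v _ _ vg v0; case.
- by move=> c u u' Pu Pu' i; rewrite dcomp_lin Pu Pu' scalerDr !scalerA mulrC.
- move=> u Pu i; rewrite (dcomp_group _ _ _ n1) Pu (opZ (rho_lin _)).
  by case: eqP => [->|_]; rewrite ?scale0r ?scaler0 //= mul0r expr0z !scale1r.
- rewrite -[\prod_(_ <- _) _]scale1r -sz -sE pactD pactN (pactXn Gl) pactC Gn.
  by rewrite subrr.
move=> z [u [u0 Pu uE]]; exists z, r, a, u; split=> //.
have zn k : iter k G u = z ^+ k *: u.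
  by elim: k => [|k IHk]; rewrite ?scale1r // iterS IHk (opZ Gl) uE scalerA exprSr.
have := Gn u; rewrite zn => /eqP; rewrite -subr_eq0 -scalerBl scaler_eq0 (negPf u0) orbF.
by rewrite subr_eq0 => /eqP.
Qed.

(** * The basis y^k v of a simple module *)

Section Basis.
Variables (al bet : K) (r i : int) (v : V).
Hypothesis w_gt0 : (0 < w)%N.
Hypothesis al_bet : al ^+ w = bet ^+ n.
Hypothesis xE : forall s u, rho (pbw s 0 0) u = al ^ s *: u.
Hypothesis gE : (1 < n)%N -> rho (pbw 0 1 0) v = bet *: v.
Hypothesis v_neq0 : v != 0.
Hypothesis v_group : forall j, dcomp v j = (j == pbw r i 0)%:R *: v.

Local Notation G := (rho (pbw 0 1 0)).
Local Notation Y := (rho (pbw 0 0 1)).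
Local Notation vk k := (iter k Y v).
Local Notation b := (bet * gam ^ i).

Lemma rho_decomp k u : reduced n k -> rho k u = al ^ k.1.1 *: iter k.1.2 G (iter k.2 Y u).
Proof.
move=> kr; case/andP: (kr) => k1 k2; rewrite {1}(pbw_reduced kr).
rewrite rho_y_iter // rho_g_iter rhoME // (mul0r 0) expr0z scale1r -xE rhoME //.
by rewrite (mul0r _) expr0z scale1r !addr0 !add0r.
Qed.

Lemma g_vk k : (1 < n)%N -> G (vk k) = (bet * (gam ^+ k)^-1) *: vk k.
Proof.
move=> n1; elim: k => [|k IHk] /=; first by rewrite expr0 invr1 mulr1 gE.
have GY u : G (Y u) = gam^-1 *: Y (G u).
  rewrite !rhoME ?addn0 ?add0n // mulr0 mulr1 expr0z scale1r scalerA.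
  by rewrite -[gam ^ 1]/gam mulVf ?gam_neq0 // scale1r !addr0 !add0r.
rewrite GY IHk (opZ (rho_lin _)) scalerA; congr (_ *: _).
by rewrite exprS invfM mulrCA.
Qed.

Lemma y_pow u : (1 < n)%N -> iter n Y u = (1 - bet ^+ n) *: u.
Proof. by move=> n1; rewrite rho_y_pow // xE -al_bet scalerBl scale1r. Qed.

(** Induction with [dcomp_y]: since g scales v_l by bet gam^(-l) and y sends v_l to v_(l+1), its
    summands regroup to the recursion. *)
Lemma dcomp_vk k m : (k < n)%N ->
  dcomp (vk k) m = \sum_(l < k.+1) hcoef (cc n w gam bet r i k l) m *: vk l.
Proof.
elim: k m => [|k IHk] m kn.
  by rewrite big_ord1 /= cstartE hcoef1 mul1r v_group eq_sym.
have n1 : (1 < n)%N by lia.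
rewrite iterS (@dcomp_y _ m _ (fun l : 'I_k.+1 => cc n w gam bet r i k l) (fun l => vk l) n1).
- under [RHS]eq_bigr do rewrite hcoef_ccS scalerDl.
  (* At l = k + 1 the first two summands of the recursion vanish, and at l = 0 the third does; the
     third sum is then shifted by one. *)
  rewrite [RHS]big_split /= [X in _ = X + _]big_ord_recr /=.
  have h0 h : hcoef (hmul [::] h) m = 0 by rewrite hcoef_hmul big_nil.
  rewrite cc_gt // h0 (_ : hmul Ye [::] = [::]); last first.
    by rewrite /Defs.hmul; elim: (Ye).
  rewrite h0 mulr0 addr0 scale0r addr0 [X in _ = _ + X]big_ord_recl /= scale0r add0r.
  rewrite -big_split; apply: eq_bigr => l _ /=.
  rewrite g_vk // scalerA scalerDl [_ * hcoef _ _]mulrC.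
  by rewrite addrC addrA add0n [RHS]addrC addrA.
- by move=> l p; apply: cc_reduced.
by move=> m'; apply: IHk; apply: ltnW.
Qed.

(** * Comparison of a simple module with a standard one *)

Local Notation m := (mdim n gam bet i).

Definition lincomb (u : 'rV[K]_m.+1) : V := \sum_(k < m.+1) u 0 k *: vk k.

Lemma lincomb_lin a u u' : lincomb (a *: u + u') = a *: lincomb u + lincomb u'.
Proof.
rewrite /lincomb scaler_sumr -big_split; apply: eq_bigr => k _ /=.
by rewrite !mxE scalerDl scalerA.
Qed.

Let m_lt_n : (m < n)%N. Proof. by case: (mdimP bet i). Qed.

Lemma dcomp_lincomb u j :
  dcomp (lincomb u) j =
  \sum_(k < m.+1) u 0 k *: \sum_(l < k.+1) hcoef (cc n w gam bet r i k l) j *: vk l.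
Proof.
rewrite /lincomb (op_sum (dcomp_lin _)); apply: eq_bigr => k _.
by rewrite (opZ (dcomp_lin _)) dcomp_vk // (leq_trans (ltn_ord k)).
Qed.

Lemma dcomp_lincomb_bot u (k : 'I_m.+1) :
  dcomp (lincomb u) (pbw r (i - k%:Z) k) = (u 0 k * ccoef b k 0) *: v.
Proof.
have kn (k' : 'I_m.+1) : (k' < n)%N by rewrite (leq_trans (ltn_ord k')).
rewrite dcomp_lincomb (bigD1 k) //= [X in _ + X]big1 ?addr0 => [|k' k'k]; last first.
  rewrite big1 ?scaler0 // => l _; have lk : (l <= k')%N by rewrite -ltnS.
  rewrite hcoef_cc_bot //.
  by rewrite -val_eqE in k'k; rewrite (negPf k'k) scale0r.
rewrite big_ord_recl hcoef_cc_bot // eqxx big1 ?addr0 => [|l _]; last first.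
  by rewrite hcoef_cc_bot ?(leq_trans (ltn_ord l)) //= andbF scale0r.
by rewrite scalerA.
Qed.

(** The component at x^r g^(i-k) y^k is [v] times the k-th coordinate times [ccoef b k 0], which is
    nonzero for k <= m. *)
Lemma lincomb_inj : injective lincomb.
Proof.
move=> u u' uu'; apply/rowP => k.
have := dcomp_lincomb_bot u k; rewrite uu' dcomp_lincomb_bot.
move/eqP; rewrite -subr_eq0 -scalerBl scaler_eq0 (negPf v_neq0) orbF -mulrBl.
rewrite mulf_eq0 (negPf (ccoef0_neq0 _)) ?orbF; last by rewrite -ltnS.
by rewrite subr_eq0 => /eqP.
Qed.

Hypothesis simpleV : simpleYD n rho delta.

Lemma iter_y_comm k k' : iter k Y (vk k') = vk (k + k')%N.
Proof. by rewrite iterD. Qed.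

Lemma iter_g_vk a k : (1 < n)%N -> iter a G (vk k) = (bet * (gam ^+ k)^-1) ^+ a *: vk k.
Proof.
move=> n1; elim: a => [|a IHa]; first by rewrite expr0 scale1r.
by rewrite iterS IHa (opZ (rho_lin _)) g_vk // scalerA exprSr.
Qed.

Lemma rho_vk k k' : reduced n k -> exists c, rho k (vk k') = c *: vk (k.2 + k')%N.
Proof.
move=> kr; rewrite rho_decomp // iter_y_comm.
case: (ltnP 1 n) => n1; last first.
  have -> : k.1.2 = 0%N by move: kr => /andP[]; case: (k.1.2) => // x; lia.
  by exists (al ^ k.1.1).
by rewrite iter_g_vk // scalerA; eexists.
Qed.

(* If nonzero, [vk m.+1] would be group-like, so V = Y V, although Y is nilpotent. *)
Lemma vk_top : (m.+1 < n)%N -> vk m.+1 = 0.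
Proof.
move=> mn; have [_ _ /(_ mn) [bm bn]] := mdimP bet i.
have n1 : (1 < n)%N by lia.
have [//|vm0] := eqVneq (vk m.+1) 0.
have vm_group j : dcomp (vk m.+1) j = (j == pbw r (i - m.+1%:Z) 0)%:R *: vk m.+1.
  rewrite dcomp_vk // big_ord_recr big1 /= ?add0r => [|l _].
    by rewrite (ccE _ _ _ mn (leqnn _)) ccoef_diag hcoef1 mul1r subnn eq_sym.
  rewrite (ccE _ _ _ mn) ?(ltnW (ltn_ord l)) // ccoef_eq0 -1?ltnS //.
  by rewrite hcoef1 mul0r scale0r.
have Ysurj x : exists x', x = Y x'.
  have [C Cr ->] := generated_all simpleV vm0 vm_group x.
  elim: C Cr => [|p C IHC] Cr.
    by exists 0; rewrite /actH big_nil (op0 (rho_lin _)).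
  have [|x' Hx'] := IHC; first by move=> p' pC; apply: Cr; rewrite inE pC orbT.
  have [c Hc] := rho_vk m.+1 (Cr _ (mem_head _ _)).
  (* A basis element of y-degree l sends v_(m+1) to a multiple of v_(l+m+1) = y v_(l+m). *)
  exists ((p.1 * c) *: vk (p.2.2 + m)%N + x').
  by rewrite rho_lin -Hx' /actH big_cons Hc scalerA addnS.
have Ysurjk k : exists x', v = iter k Y x'.
  elim: k => [|k [x' ->]]; first by exists v.
  by have [x'' ->] := Ysurj x'; exists x''; rewrite iterSr.
(* Here y^n acts by 1 - bet^n = 0, so that v would be zero. *)
have [x' vx] := Ysurjk n; move: v_neq0.
by rewrite vx y_pow // bn subrr scale0r eqxx.
Qed.

Lemma vk_gt k : (m < k < n)%N -> vk k = 0.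
Proof.
case/andP=> mk kn; have mn : (m.+1 < n)%N by apply: leq_ltn_trans mk kn.
have := vk_top mn; rewrite -(subnK mk) iterD => ->.
by rewrite (iter_op0 (rho_lin _)).
Qed.

(** For m = n - 1 this is the relation for y^n; for smaller m both sides are zero. *)
Lemma y_vk_m : (1 < n)%N -> Y (vk m) = (1 - bet ^+ n) *: v.
Proof.
move=> n1; rewrite -iterS; move: m_lt_n; rewrite leq_eqVlt => /orP[/eqP ->|mn].
  by rewrite y_pow.
by rewrite vk_top //; have [_ _ /(_ mn) [_ ->]] := mdimP bet i; rewrite subrr scale0r.
Qed.

Lemma lincomb_delta (k : 'I_m.+1) : lincomb (delta_mx 0 k) = vk k.
Proof.
rewrite /lincomb (bigD1 k) //= mxE !eqxx scale1r big1 ?addr0 // => k' /negPf kk.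
by rewrite mxE kk andbF scale0r.
Qed.

(** V = H v is spanned by the v_k with k < n, and those with k > m vanish. *)
Lemma lincomb_surj x : exists u, lincomb u = x.
Proof.
have vj j : dcomp (vk 0) j = (j == pbw r i 0)%:R *: vk 0 := v_group j.
have [C Cr ->] := generated_all simpleV v_neq0 vj x.
elim: C Cr => [|p C IHC] Cr.
  by exists 0; rewrite /lincomb /actH big_nil big1 // => k _; rewrite mxE scale0r.
have [|u Hu] := IHC; first by move=> p' pC; apply: Cr; rewrite inE pC orbT.
have pr := Cr _ (mem_head _ _); case/andP: (pr) => _ p2.
have [c Hc] := rho_vk 0 pr; rewrite addn0 in Hc.
have [k Hk] : exists u', lincomb u' = vk p.2.2.
  case: (ltnP m p.2.2) => pm; last first.
    by exists (delta_mx 0 (Ordinal (pm : (p.2.2 < m.+1)%N))); rewrite lincomb_delta.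
  by exists 0; rewrite vk_gt ?pm // (op0 lincomb_lin).
exists ((p.1 * c) *: k + u); rewrite lincomb_lin Hu Hk /actH big_cons.
by rewrite -[v]/(vk 0) Hc scalerA.
Qed.

Lemma lincomb_Gop u : (1 < n)%N -> lincomb (Gop u) = G (lincomb u).
Proof.
move=> n1; rewrite /lincomb (op_sum (rho_lin _)); apply: eq_bigr => k _.
by rewrite mxE (opZ (rho_lin _)) g_vk // scalerA mulrC.
Qed.

Lemma lincomb_Yop u : (1 < n)%N -> lincomb (Yop u) = Y (lincomb u).
Proof.
(* [Yop] moves the last coordinate to the front, so the first term on the left is matched with the
   last one on the right. *)
move=> n1; rewrite /lincomb (op_sum (rho_lin _)) [RHS]big_ord_recr big_ord_recl /=.
rewrite !(opZ (rho_lin _)) y_vk_m // mxE eqxx scalerA [in RHS]addrC.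
congr (_ + _); first by rewrite mulrC; congr ((u 0 _ * _) *: _); apply: val_inj.
apply: eq_bigr => k _; rewrite mxE /= (opZ (rho_lin _)); congr (u 0 _ *: _).
by apply: val_inj; rewrite /= add0n inordK // ltnS ltnW.
Qed.

Lemma lincomb_rho k u : reduced n k -> lincomb (Vrho al k u) = rho k (lincomb u).
Proof.
move=> kr; rewrite rho_decomp //; case: k kr => [[s a] l] /andP[/= an ln].
rewrite (opZ lincomb_lin); congr (_ *: _).
case: (ltnP 1 n) => n1; last first.
  by have [-> ->] : a = 0%N /\ l = 0%N by lia.
have -> : iter l Y (lincomb u) = lincomb (iter l (@Yop K n gam bet i) u).
  by elim: l {ln} => //= l ->; rewrite lincomb_Yop.
by elim: a {an} => //= a IHa; rewrite lincomb_Gop // IHa.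
Qed.

Lemma lincomb_dcomp u j : lincomb (Defs.dcomp (@Vdelta K n w gam bet r i) u j) = dcomp (lincomb u) j.
Proof.
rewrite dcomp_Vdelta dcomp_lincomb (op_sum lincomb_lin); apply: eq_bigr => k _.
rewrite (op_sum lincomb_lin) scaler_sumr.
rewrite (big_ord_widen m.+1 (fun l => u 0 k *: (hcoef (cc n w gam bet r i k l) j *: vk l))) //.
rewrite [RHS]big_mkcond; apply: eq_bigr => l _.
rewrite (opZ lincomb_lin) lincomb_delta scalerA; case: ifP => // /negbT.
by rewrite -ltnNge ltnS => kl; rewrite cc_gt // /hcoef big_nil mulr0 scale0r.
Qed.

(** The isomorphism is the inverse of [lincomb], obtained by choosing preimages. *)
Lemma basis_YDiso : YDiso n rho delta (@Vrho K n gam al bet i) (@Vdelta K n w gam bet r i).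
Proof.
have ex x : exists u, lincomb u == x by have [u /eqP] := lincomb_surj x; exists u.
pose f x := xchoose (ex x).
have fK x : lincomb (f x) = x by apply/eqP/(xchooseP (ex x)).
exists f; split; first by move=> a x y; apply: lincomb_inj; rewrite lincomb_lin !fK.
split; first by exists lincomb => // u; apply: lincomb_inj; rewrite fK.
split=> [k x kr|x j]; apply: lincomb_inj; first by rewrite lincomb_rho // !fK.
by rewrite lincomb_dcomp !fK.
Qed.
End Basis.
End YDModule.

Lemma simple_YDiso (V : lmodType K) (rho : idx -> V -> V) (delta : V -> seq (idx * V)) :
  (0 < w)%N ->
  (forall p : {poly K}, exists s : seq K, p = lead_coef p *: \prod_(z <- s) ('X - z%:P)) ->
  isYD n w gam rho delta -> simpleYD n rho delta ->
  exists (al bet : K) (r i : int),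
    [/\ al != 0, bet != 0, al ^+ w = bet ^+ n &
      YDiso n rho delta (@Vrho K n gam al bet i) (@Vdelta K n w gam bet r i)].
Proof.
move=> w_gt0 K_split YD simpleV; have [V0 _] := simpleV.
have [al al0 xE] := x_scalar YD K_split simpleV.
have [bet [r [a [v [bE v0 gE vg]]]]] := exists_g_eigenvector YD K_split V0 xE.
have bet0 : bet != 0.
  apply: contraNneq al0 => b0; move/esym/eqP: bE.
  by rewrite b0 expr0n eqn0Ngt n_gt0 expf_eq0 w_gt0.
exists al, bet, r, a%:Z; split=> //.
exact: (basis_YDiso YD w_gt0 (esym bE) xE gE v0 vg simpleV).
Qed.

(** * Isomorphisms between the standard modules *)

(** Once the equal dimensions are identified, the identity map is an isomorphism, as coactions are
    compared through coefficients only. *)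
Lemma YDiso_dim m m' al bet (C C' : nat -> nat -> Hf K) :
  m = m' -> (forall k l, heq (C k l) (C' k l)) ->
  YDiso n (@Vrho_dim m al bet) (Vdelta_dim C) (@Vrho_dim m' al bet) (Vdelta_dim C').
Proof.
move=> <- CC; exists id; do !split=> //; first by exists id.
move=> v j; rewrite !dcomp_Vdelta_dim.
by apply: eq_bigr => k _; apply: eq_bigr => l _; rewrite CC.
Qed.

Lemma heq_cc bet r i r' i' : heq (cstart n w gam r i) (cstart n w gam r' i') ->
  forall k l, heq (cc n w gam bet r i k l) (cc n w gam bet r' i' k l).
Proof.
move=> cE; elim=> [|k IHk] l /=; first by case: ifP.
by do ![case: ifP => _ | apply: heq_cat | apply: heq_scale | apply: heq_hmul | exact: IHk | by []].
Qed.

Lemma heq_cstart r i r' i' :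
  heq (cstart n w gam r i) (cstart n w gam r' i') <-> pbw r i 0 = pbw r' i' 0.
Proof.
split=> [/(_ (pbw r i 0))|H]; rewrite !cstartE ?H // !hcoef1 eqxx !mul1r.
by case: eqP => // _ /eqP; rewrite oner_eq0.
Qed.

(** Equality of the group-likes changes i by a multiple of n, and phi depends only on residues
    modulo n. *)
Lemma mdim_eq bet r i r' i' : pbw r i 0 = pbw r' i' 0 -> mdim n gam bet i = mdim n gam bet i'.
Proof.
case/pbw_inj => d -> _; rewrite /mdim; case: pickP => // j _.
rewrite /phi; congr (n - (absz _).+1)%N.
rewrite (_ : - (i + d * n%:Z) - j%:Z - 1 = (- d) * n%:Z + (- i - j%:Z - 1)); last by ring.
by rewrite modzMDl.
Qed.

Lemma dcomp_V_bot bet r i u (k : 'I_(mdim n gam bet i).+1) : (0 < w)%N ->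
  dcomp (@Vdelta K n w gam bet r i) u (pbw r (i - k%:Z) k) =
  (u 0 k * ccoef (bet * gam ^ i) k 0) *: delta_mx 0 0.
Proof.
move=> w_gt0; have [mn _ _] := mdimP bet i.
have kn (k' : 'I_(mdim n gam bet i).+1) : (k' < n)%N by rewrite (leq_trans (ltn_ord k')).
rewrite dcomp_Vdelta (bigD1 k) //= [X in _ + X]big1 ?addr0 => [|k' k'k]; last first.
  rewrite big1 // => l _; case: (leqP l k') => lk.
    rewrite hcoef_cc_bot //; rewrite -val_eqE in k'k.
    by rewrite (negPf k'k) mulr0 scale0r.
  by rewrite cc_gt // /hcoef big_nil mulr0 scale0r.
rewrite big_ord_recl hcoef_cc_bot // eqxx big1 ?addr0 // => l _.
case: (leqP (lift ord0 l) k) => lk; last by rewrite cc_gt // /hcoef big_nil mulr0 scale0r.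
by rewrite hcoef_cc_bot //= andbF mulr0 scale0r.
Qed.

Lemma dcomp_V0 bet r i j :
  dcomp (@Vdelta K n w gam bet r i) (delta_mx 0 0) j = (pbw r i 0 == j)%:R *: delta_mx 0 0.
Proof.
rewrite dcomp_Vdelta (bigD1 ord0) //= [X in _ + X]big1 ?addr0 => [|k /negPf k0]; last first.
  by rewrite big1 // => l _; rewrite mxE k0 andbF mul0r scale0r.
rewrite big_ord_recl big1 ?addr0 => [|l _]; last by rewrite /= /hcoef big_nil mulr0 scale0r.
by rewrite mxE !eqxx /= cstartE hcoef1 !mul1r.
Qed.

Lemma V_YDisoP al bet r i al' bet' r' i' : (0 < w)%N ->
  al ^+ w = bet ^+ n -> al' ^+ w = bet' ^+ n ->
  YDiso n (@Vrho K n gam al bet i) (@Vdelta K n w gam bet r i)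
          (@Vrho K n gam al' bet' i') (@Vdelta K n w gam bet' r' i') <->
  [/\ al = al', bet = bet' & heq (cstart n w gam r i) (cstart n w gam r' i')].
Proof.
move=> w_gt0 ab ab'; split=> [|[<- <- /[dup] ch /heq_cstart cE]]; last first.
  exact: (@YDiso_dim _ _ al bet _ _ (mdim_eq bet cE) (heq_cc bet ch)).
case=> f [f_lin [f_bij [f_rho f_dcomp]]].
pose e := delta_mx 0 0 : 'rV[K]_(mdim n gam bet i).+1.
have e0 : e != 0.
  by apply/eqP => /matrixP/(_ 0 0)/eqP; rewrite !mxE !eqxx oner_eq0.
have u0 : f e != 0.
  by apply: contraNneq e0 => fe; apply/eqP/(bij_inj f_bij); rewrite fe (op0 f_lin).
have uE j : dcomp (@Vdelta K n w gam bet' r' i') (f e) j = (pbw r i 0 == j)%:R *: f e.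
  by rewrite -f_dcomp dcomp_V0 (opZ f_lin).
(* For k > 0 the marker x^r' g^(i'-k) y^k contains y and so differs from the group-like x^r g^i; its
   component, and with it the k-th coordinate, is zero. *)
have uk (k : 'I_(mdim n gam bet' i').+1) : k != ord0 -> f e 0 k = 0.
  move=> k0; have := uE (pbw r' (i' - k%:Z) k); rewrite dcomp_V_bot // eq_pbw.
  rewrite [(0 == k :> nat)%N]eq_sym (_ : (k == 0 :> nat) = false) ?andbF ?scale0r; last first.
    by apply: negPf.
  move=> /matrixP/(_ 0 0)/eqP; rewrite !mxE !eqxx mulr1 mulf_eq0.
  by rewrite (negPf (ccoef0_neq0 _)) ?orbF => [/eqP|]; last by rewrite -ltnS.
have u00 : f e 0 0 != 0.
  apply: contraNneq u0 => u00; apply/eqP/rowP => k; rewrite [RHS]mxE.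
  by have [->|/uk] := eqVneq k ord0.
(* The component of [f e] at x^r' g^i' carries the nonzero coordinate 0, which is possible only if
   the two group-likes coincide. *)
have cE : pbw r i 0 = pbw r' i' 0.
  have := uE (pbw r' (i' - 0) 0); rewrite (dcomp_V_bot r' _ ord0) // subr0.
  case: eqP => // _; rewrite scale0r ccoef_diag mulr1.
  move=> /matrixP/(_ 0 0)/eqP; rewrite !mxE !eqxx mulr1.
  by rewrite (negPf u00).
have alE : al = al'.
  have := f_rho (pbw 1 0 0) e; rewrite reduced_pbw pbw_nat // => /(_ n_gt0).
  rewrite /= (opZ f_lin) => /rowP/(_ 0); rewrite !mxE => /(mulIf u00).
  by [].
split=> //; last exact/heq_cstart.
(* For n = 1 the index of g is not reduced, but the constraints give bet = al^w and bet' = al'^w. *)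
case: (ltnP 1 n) => n1; last first.
  have n1E : n = 1%N by lia.
  by move: ab ab'; rewrite alE n1E !expr1 => -> ->.
have := f_rho (pbw 0 1 0) e; rewrite reduced_pbw (@pbw_nat 0 1) // => /(_ n_gt0).
rewrite /= !expr0z !scale1r.
have -> : Gop e = bet *: e.
  apply/rowP => k; rewrite !mxE; case: (eqVneq k 0) => [->|_]; last by rewrite !mulr0.
  by rewrite expr0 invr1 mulr1.
rewrite (opZ f_lin) => /rowP/(_ 0); rewrite !mxE expr0 invr1 mulr1.
by move/(mulIf u00).
Qed.
End Algebra.

Theorem theorem4p3 (K : closedFieldType) (n w : nat) (gam : K) :
  [pchar K] =i pred0 -> (0 < n)%N -> (0 < w)%N -> n.-primitive_root gam ->
  (* (1) classification of simple Yetter-Drinfeld modules *)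
  (forall (V : lmodType K) (rho : idx -> V -> V) (delta : V -> seq (idx * V)),
     isYD n w gam rho delta -> simpleYD n rho delta ->
     exists (al bet : K) (r i : int),
       [/\ al != 0, bet != 0, al ^+ w = bet ^+ n &
           YDiso n rho delta (@Vrho K n gam al bet i)
                             (@Vdelta K n w gam bet r i)]) /\
  (* (2) isomorphism criterion *)
  (forall (al bet al' bet' : K) (r i r' i' : int),
     al != 0 -> bet != 0 -> al ^+ w = bet ^+ n ->
     al' != 0 -> bet' != 0 -> al' ^+ w = bet' ^+ n ->
     (YDiso n (@Vrho K n gam al bet i) (@Vdelta K n w gam bet r i)
              (@Vrho K n gam al' bet' i') (@Vdelta K n w gam bet' r' i')
      <-> [/\ al = al', bet = bet' & heq (cstart n w gam r i) (cstart n w gam r' i')])).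
Proof.
move=> _ n_gt0 w_gt0 gam_prim; split=> [V rho delta YD simpleV|].
  apply: (simple_YDiso n_gt0 gam_prim w_gt0 _ YD simpleV) => p.
  by have [s ps] := closed_field_poly_normal p; exists s.
by move=> al bet al' bet' r i r' i' _ _ ab _ _ ab'; apply: V_YDisoP.
Qed.
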